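(* Assume that for every $t>0$ the operator $P^{\tau_{\mathcal O}}_t h(x)=\mathbb{E}^x\{1_{\{t<\tau_{\mathcal O}\}}h(X(t))\}$ maps the space of continuous bounded functions $E\to\mathbb{R}$ into itself. Then for every $s\ge 0$ and every $x\in\partial\mathcal O$, $$\lim_{y\to x,\ y\in\mathcal O} w(s,y)=\max\{G(s,x),H(s,x)\}.$$
   Context: Setting. $E$ is a locally compact separable space with a metric $\rho$ for which every closed ball is compact. $(X(t))_{t\ge0}$ is a standard Markov process on $E$ (strong Markov, càdlàg, quasi-left-continuous, with complete right-continuous filtration) with laws $\mathbb{P}^x$ and expectations $\mathbb{E}^x$, $x\in E$. It is weakly Feller: $P_t\mathcal C_0\subseteq\mathcal C_0$, where $P_th(x)=\mathbb{E}^x\{h(X(t))\}$ and $\mathcal C_0$ is the space of continuous bounded functions $E\to\mathbb{R}$ vanishing at infinity. $\mathcal O\subset E$ is an open set and $\tau_{\mathcal O}=\inf\{t\ge0: X(t)\notin\mathcal O\}$. $\alpha>0$, and $f,G,H:[0,\infty)\times E\to\mathbb{R}$ are continuous bounded functions. For $(s,x)\in[0,\infty)\times E$ and a stopping time $\tau$ (possibly infinite), $$J(s,x,\tau)=\mathbb{E}^x\Big\{\int_0^{\tau\wedge\tau_{\mathcal O}}e^{-\alpha u}f(s+u,X(u))\,du+1_{\{\tau<\tau_{\mathcal O}\}}e^{-\alpha\tau}G(s+\tau,X(\tau))+1_{\{\tau\ge\tau_{\mathcal O}\}}e^{-\alpha\tau_{\mathcal O}}H(s+\tau_{\mathcal O},X(\tau_{\mathcal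 O}))\Big\},$$ where discounted terminal payoffs at an infinite time are read as $0$. The value function is $w(s,x)=\sup_\tau J(s,x,\tau)$, the supremum being over all stopping times. *)

(* Defs.v *)
From HB Require Import structures.
From mathcomp Require Import all_boot all_order all_algebra.
From mathcomp Require Import all_classical all_reals all_analysis.
From mathcomp Require Import measurable_realfun.

Set Implicit Arguments.
Unset Strict Implicit.
Unset Printing Implicit Defensive.

Import Order.TTheory GRing.Theory Num.Theory.
Import numFieldNormedType.Exports.

Local Open Scope classical_set_scope.
Local Open Scope ring_scope.

(* The library's measurable types are pointed, so the Borel sigma-algebra is
   only available as a measurableType on a nonempty metric space. *)
#[short(type="pointedMetricType")]
HB.structure Definition PointedMetric (K : numDomainType) :=
  {M of Pointed M & Metric K M}.

Notation borel E := (g_sigma_algebraType (@open E)).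

Section StateSpace.
Context {R : realType} (E : pointedMetricType R).

(* [closed_ball] of the library is the closure of the open ball, which may be
   smaller than the set below. *)
Definition closed_balls_compact : Prop :=
  forall (x : E) (r : R), compact [set y : E | mdist x y <= r].

Definition separable_space : Prop :=
  exists S : set E, countable S /\ dense S.

Definition boundary (O : set E) : set E := closure O `\` interior O.

Definition Cb : set (E -> R) :=
  [set h | continuous h /\ [bounded h x | x in [set: E]]].

Definition C0 : set (E -> R) :=
  [set h | Cb h /\ forall eps : R, 0 < eps ->
     exists2 K : set E, compact K & forall x, ~ K x -> `|h x| < eps].

(* Continuous bounded functions on [0, +oo[ * E; the values at negative times
   of the total functions representing them are irrelevant. *)
Definition Cb_time_space : set (R * E -> R) :=
  [set g | {within [set p : R * E | 0 <= p.1], continuous g} /\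
           [bounded g p | p in [set p : R * E | 0 <= p.1]]].

Definition cadlag (x : R -> E) : Prop :=
  (forall t : R, 0 <= t -> x u @[u --> t^'+] --> x t) /\
  (forall t : R, 0 < t -> exists l : E, x u @[u --> t^'-] --> l).

End StateSpace.

(* Time is indexed by R, only the indices t >= 0 being meaningful: [F t] is the
   sigma-algebra at time t, [X t w] the position at time t on the path w. *)
Section Process.
Context {R : realType} (E : pointedMetricType R).
Context {d : measure_display} (Omega : measurableType d).
Variables (F : R -> set (set Omega)) (X : R -> Omega -> E)
  (P : E -> probability Omega R).

Definition filtration : Prop :=
  [/\ forall t : R, 0 <= t -> sigma_algebra setT (F t),
      forall t : R, 0 <= t -> F t `<=` measurable &
      forall s t : R, 0 <= s -> s <= t -> F s `<=` F t].

Definition right_continuous_filtration : Prop :=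
  forall t : R, 0 <= t -> F t = \bigcap_(s in [set s : R | t < s]) F s.

Definition universally_measurable (g : E -> \bar R) : Prop :=
  forall mu : probability (borel E) R, exists2 g' : borel E -> \bar R,
    measurable_fun setT g' & {ae mu, forall x, g x = g' x}.

(* The probability P^mu of A for the initial distribution mu. *)
Definition initial_law (mu : probability (borel E) R) (A : set Omega) : \bar R :=
  (\int[mu]_x P x A)%E.

Definition completion_in (mu : probability (borel E) R)
    (G : set (set Omega)) : set (set Omega) :=
  [set A | exists B N, [/\ G B, measurable N, initial_law mu N = 0%E &
                           A `+` B `<=` N]].

(* Completeness is relative to the whole family of laws P^mu, as usual for
   Markov processes; completing with respect to each P^x separately would be
   too strong. *)
Definition complete_filtration : Prop :=
  forall t : R, 0 <= t -> forall A,
    (forall mu : probability (borel E) R, completion_in mu (F t) A) -> F t A.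

Definition adapted : Prop :=
  forall t : R, 0 <= t -> forall B : set (borel E), measurable B ->
    F t (X t @^-1` B).

Definition stopping_time (tau : Omega -> \bar R) : Prop :=
  (forall w, (0 <= tau w)%E) /\
  forall t : R, 0 <= t -> F t [set w | (tau w <= t%:E)%E].

Definition stopped_sigma (tau : Omega -> \bar R) : set (set Omega) :=
  [set A | measurable A /\
     forall t : R, 0 <= t -> F t (A `&` [set w | (tau w <= t%:E)%E])].

Definition strong_markov : Prop :=
  forall (x : E) (tau : Omega -> \bar R), stopping_time tau ->
  forall A, stopped_sigma tau A ->
  forall t : R, 0 <= t -> forall B : set (borel E), measurable B ->
    P x (A `&` [set w | (tau w < +oo)%E]
           `&` [set w | B (X (fine (tau w) + t) w)]) =
    (\int[P x]_(w in A `&` [set w | (tau w < +oo)%E])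
        P (X (fine (tau w)) w) (X t @^-1` B))%E.

Definition quasi_left_continuous : Prop :=
  forall (T : nat -> Omega -> \bar R) (tau : Omega -> \bar R),
  (forall n, stopping_time (T n)) ->
  (forall w, nondecreasing_seq (T ^~ w)) ->
  (forall w, T n w @[n --> \oo] --> tau w) ->
  forall x : E, {ae P x, forall w, (tau w < +oo)%E ->
    X (fine (T n w)) w @[n --> \oo] --> X (fine (tau w)) w}.

(* Conservative (infinite lifetime), since the paths stay in E. *)
Record standard_markov_process : Prop := StandardMarkovProcess {
  smp_filtration : filtration ;
  smp_right_continuous : right_continuous_filtration ;
  smp_complete : complete_filtration ;
  smp_adapted : adapted ;
  smp_transition_measurable : forall t : R, 0 <= t ->
    forall B : set (borel E), measurable B ->
    measurable_fun setT ((fun x => P x (X t @^-1` B)) : borel E -> \bar R) ;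
  smp_law_measurable : forall A : set Omega, measurable A ->
    universally_measurable (fun x => P x A) ;
  smp_normal : forall x, P x [set w | X 0 w = x] = 1%E ;
  smp_strong_markov : strong_markov ;
  smp_cadlag : forall w, cadlag (X ^~ w) ;
  smp_quasi_left_continuous : quasi_left_continuous
}.

Definition semigroup (t : R) (h : E -> R) (x : E) : R :=
  \int[P x]_w h (X t w).

Definition weakly_feller : Prop :=
  forall t : R, 0 <= t -> forall h, C0 h -> C0 (semigroup t h).

Definition exit_time (O : set E) (w : Omega) : \bar R :=
  ereal_inf [set t%:E | t in [set t : R | 0 <= t /\ ~ O (X t w)]].

Definition killed_semigroup (O : set E) (t : R) (h : E -> R) (x : E) : R :=
  \int[P x]_w (\1_[set w' | (t%:E < exit_time O w')%E] w * h (X t w)).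

Definition discounted_payoff (alpha : R) (g : R * E -> R) (s : R)
    (T : \bar R) (w : Omega) : R :=
  if T is t%:E then expR (- alpha * t) * g (s + t, X t w) else 0.

Definition running_payoff (alpha : R) (f : R * E -> R) (s : R)
    (T : \bar R) (w : Omega) : R :=
  \int[lebesgue_measure]_(u in [set u : R | 0 <= u /\ (u%:E <= T)%E])
     (expR (- alpha * u) * f (s + u, X u w)).

Definition J (O : set E) (alpha : R) (f G H : R * E -> R) (s : R) (x : E)
    (tau : Omega -> \bar R) : \bar R :=
  'E_(P x)[fun w =>
    (running_payoff alpha f s (Order.min (tau w) (exit_time O w)) w
     + \1_[set w' | (tau w' < exit_time O w')%E] w
         * discounted_payoff alpha G s (tau w) w
     + \1_[set w' | (exit_time O w' <= tau w')%E] w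
         * discounted_payoff alpha H s (exit_time O w) w)%R]%E.

Definition value (O : set E) (alpha : R) (f G H : R * E -> R) (s : R) (x : E) :
    \bar R :=
  ereal_sup [set J O alpha f G H s x tau | tau in [set tau | stopping_time tau]].

End Process.

(* Main.v *)
Require Import Defs.
From HB Require Import structures.
From mathcomp Require Import all_boot all_order all_algebra.
From mathcomp Require Import all_classical all_reals all_analysis.
From mathcomp Require Import measurable_realfun.
From mathcomp Require Import ring lra.

(* Since [x] lies outside [O], the killed semigroup sends the constant 1 to a
   continuous function vanishing at [x]; hence the exit time tends to 0 in
   probability when the starting point [y] tends to [x].  It remains to see that
   a path started near [x] stays near [x] during a short time, with a
   probability that is uniformly close to 1.  Then, for every stopping time, the
   payoff is close to [G (s, x)] or to [H (s, x)] according to whether the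
   process is stopped before or at the exit from [O], and the stopping times 0
   and [+oo] show that both values are attained in the limit.

   Uniform confinement uses the time averages [u_r] of [t |-> P_(r t) phi] over
   [t] in [[0, 1[], where [phi] is a bump function at [x].  They belong to C0,
   satisfy [|P_t u_r - u_r| <= t / r] (up to restricting [t] to a grid), and
   separate [x] from the complement of a ball when [r] tends to 0.  So
   [|u_r - u_r x|] is nearly subharmonic, and discrete optional stopping bounds
   the probability of leaving the ball before time [eps] by the expectation of
   such functions at time [eps] alone, which is continuous in [y]. *)

Set Implicit Arguments.
Unset Strict Implicit.
Unset Printing Implicit Defensive.

Import Order.TTheory GRing.Theory Num.Theory.
Import numFieldNormedType.Exports.

Local Open Scope classical_set_scope.
Local Open Scope ring_scope.

(** * Integration without measurability, and dyadic Riemann sums *)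

(* Unlike [ge0_le_integral], this holds without measurability; it is what lets
   payoffs at the possibly non-measurable exit time be estimated. *)
Lemma le_integral_nomeas d (T : measurableType d) (R : realType)
    (mu : {measure set T -> \bar R}) (D : set T) (f g : T -> \bar R) :
  (forall x, D x -> (f x <= g x)%E) ->
  (\int[mu]_(x in D) f x <= \int[mu]_(x in D) g x)%E.
Proof.
move=> fg; rewrite /integral.
have fgD : forall x, ((f \_ D) x <= (g \_ D) x)%E by apply: lee_restrict.
apply: leeB; apply: ub_ereal_sup => _ [h /= hf <-]; apply: ereal_sup_ubound;
  exists h => //= x; apply: (le_trans (hf x)).
- by apply: (@funepos_le _ _ setT) => //; rewrite inE.
- by apply: (@funeneg_le _ _ setT) => //; rewrite inE.
Qed.

(** Two one-sided comparisons squeeze the integral of [f] between finite values, so that [fine] does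
    not collapse an infinite value to 0. It serves for running payoffs, as integrals in time. *)
Lemma normr_Rintegral_le d (T : measurableType d) (R : realType)
    (mu : {measure set T -> \bar R}) (D : set T) (f g : T -> R) :
  measurable D -> mu.-integrable D (EFin \o g) ->
  (forall x, D x -> `|f x| <= g x) ->
  `|\int[mu]_(x in D) f x| <= \int[mu]_(x in D) g x.
Proof.
move=> mD ig fg; have gfin := integrable_fin_num mD ig.
have h1 : (\int[mu]_(x in D) (f x)%:E <= \int[mu]_(x in D) (g x)%:E)%E.
  by apply: le_integral_nomeas => x Dx; rewrite lee_fin (le_trans _ (fg x Dx))// ler_norm.
have h2 : (- (\int[mu]_(x in D) (g x)%:E) <= \int[mu]_(x in D) (f x)%:E)%E.
  rewrite -integralN/=; last by rewrite integrable_add_def.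
  apply: le_integral_nomeas => x Dx; rewrite lee_fin lerNl.
  by rewrite (le_trans _ (fg x Dx))// -normrN ler_norm.
have ffin : (\int[mu]_(x in D) (f x)%:E)%E \is a fin_num.
  apply/fin_numP; split; apply/eqP => h.
    by move: h2; rewrite h leeNy_eq eqe_oppLR /=; apply/negP; case/fin_numP: gfin.
  by move: h1; rewrite h leye_eq; apply/negP; case/fin_numP: gfin.
rewrite ler_norml -!lee_fin /Rintegral EFinN !fineK//.
by rewrite h1 h2.
Qed.

Lemma integrable_bounded d (T : measurableType d) (R : realType)
    (mu : {measure set T -> \bar R}) (D : set T) (f : T -> R) (M : R) :
  measurable D -> (mu D < +oo)%E -> measurable_fun D f ->
  (forall x, D x -> `|f x| <= M) -> mu.-integrable D (EFin \o f).
Proof.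
move=> mD muD mf fM; apply: measurable_bounded_integrable => //.
exists M; split; first exact: num_real.
by move=> r Mr x Dx /=; rewrite (le_trans (fM x Dx))// ltW.
Qed.

Lemma bounded_cvg_Rintegral d (T : measurableType d) (R : realType)
    (mu : {measure set T -> \bar R}) (D : set T) (f_ : nat -> T -> R)
    (f : T -> R) (M : R) :
  measurable D -> (mu D < +oo)%E -> (forall n, measurable_fun D (f_ n)) ->
  (forall n x, D x -> `|f_ n x| <= M) ->
  (forall x, D x -> f_ n x @[n --> \oo] --> f x) ->
  \int[mu]_(x in D) f_ n x @[n --> \oo] --> \int[mu]_(x in D) f x.
Proof.
move=> mD muD mf fM fcvg.
have mfl : measurable_fun D f by exact: (measurable_fun_cvg mf).
have [|||||ifl _] := @dominated_convergence _ _ _ mu D mD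
    (fun n x => (f_ n x)%:E) (fun x => (f x)%:E) (cst M%:E).
- by move=> n; apply/measurable_EFinP.
- exact/measurable_EFinP.
- by apply: aeW => x Dx; apply: cvg_EFin; [exact: nearW|exact: fcvg].
- by apply: (integrable_bounded (M := `|M|)) => //=; exact: measurable_cst.
- by apply: aeW => x /= n Dx; rewrite lee_fin fM.
move=> h; apply: fine_cvg; rewrite fineK//.
exact: integrable_fin_num ifl.
Qed.

Lemma Rintegral_sum d (T : measurableType d) (R : realType)
    (mu : {measure set T -> \bar R}) (D : set T) (N : nat)
    (f : 'I_N -> T -> R) :
  measurable D -> (forall k, mu.-integrable D (EFin \o f k)) ->
  \int[mu]_(x in D) \sum_(k < N) f k x = \sum_(k < N) \int[mu]_(x in D) f k x.
Proof.
move=> mD fi; rewrite /Rintegral; under eq_integral do rewrite -sumEFin.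
rewrite (integral_sum mD fi)//= sum_fine// => k _.
exact: (integrable_fin_num mD (fi k)).
Qed.

(** These Riemann sums over [0, 1[ use the right end points of the cells, because the functions of
    time below are known to be continuous from the right. *)
Definition dyadic_mean {R : realType} (g : R -> R) (n : nat) : R :=
  2 ^- n * \sum_(k < 2 ^ n) g (k.+1%:R * 2 ^- n).

Lemma dyadic_pos {R : realType} n : 0 < 2 ^- n :> R.
Proof. by rewrite invr_gt0 exprn_gt0. Qed.

Lemma dyadic_cvg0 {R : realType} : (2 ^- n : R) @[n --> \oo] --> 0.
Proof.
have := @cvg_geometric R 1 (2^-1); rewrite ger0_norm// invf_lt1// ltr1n => /(_ isT).
by apply: cvg_trans; apply: near_eq_cvg; near=> n; rewrite /geometric/= mul1r exprVn.
Unshelve. all: by end_near. Qed.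

(** The grid point is the right end of the cell containing [t]; it lies strictly after [t], as
    limits from the right require. *)
Lemma dyadic_upper (R : realType) (t : R) n : 0 <= t ->
  t < (Num.truncn (t * 2 ^+ n)).+1%:R * 2 ^- n <= t + 2 ^- n.
Proof.
move=> t0; have p2 : 0 < 2 ^+ n :> R by rewrite exprn_gt0.
have tn0 : 0 <= t * 2 ^+ n by rewrite mulr_ge0// ltW.
have /andP[k1 k2] := truncn_itv tn0.
rewrite ltr_pdivlMr// k2/= ler_pdivrMr// mulrDl mulVf ?gt_eqF//.
by rewrite -natr1 lerD2r.
Qed.

Lemma dyadic_upper_index (R : realType) (t : R) n : 0 <= t -> t < 1 ->
  (Num.truncn (t * 2 ^+ n) < 2 ^ n)%N.
Proof.
move=> t0 t1; have p2 : 0 < 2 ^+ n :> R by rewrite exprn_gt0.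
have tn0 : 0 <= t * 2 ^+ n by rewrite mulr_ge0// ltW.
have /andP[k1 _] := truncn_itv tn0.
by rewrite -(ltr_nat R) natrX (le_lt_trans k1)// gtr_pMl.
Qed.

(** Its integral over [0, 1[ is [dyadic_mean g n], which turns convergence of Riemann sums into
    bounded convergence. *)
Definition dyadic_step {R : realType} (g : R -> R) (n : nat) (t : R) : R :=
  \sum_(k < 2 ^ n) g (k.+1%:R * 2 ^- n) *
    \1_(`[k%:R * 2 ^- n, k.+1%:R * 2 ^- n[) t.

Lemma dyadic_stepE {R : realType} (g : R -> R) (n : nat) (t : R) :
  0 <= t -> t < 1 -> dyadic_step g n t = g ((Num.truncn (t * 2 ^+ n)).+1%:R * 2 ^- n).
Proof.
move=> t0 t1; have p2 : 0 < 2 ^+ n :> R by rewrite exprn_gt0.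
have tn0 : 0 <= t * 2 ^+ n by rewrite mulr_ge0// ltW.
have /andP[k1 k2] := truncn_itv tn0.
set k := Num.truncn _ in k1 k2 *.
have kn : (k < 2 ^ n)%N by exact: dyadic_upper_index.
rewrite /dyadic_step (bigD1 (Ordinal kn))//= big1 ?addr0 => [|i ik].
  rewrite indicE mem_set ?mulr1//= in_itv/= ler_pdivrMr// k1/= ltr_pdivlMr//.
rewrite indicE memNset ?mulr0//= in_itv/= ler_pdivrMr// ltr_pdivlMr// => /andP[h1 h2].
move/eqP: ik; apply; apply: val_inj => /=; apply/eqP; rewrite eqn_leq.
have ik : (i < k.+1)%N by rewrite -(ltr_nat R) (le_lt_trans h1 k2).
have ki : (k < i.+1)%N by rewrite -(ltr_nat R) (le_lt_trans k1 h2).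
by rewrite !ltnS in ik ki; rewrite ik ki.
Qed.

Lemma dyadic_step_cvg {R : realType} (g : R -> R) (t : R) :
  (forall u, 0 <= u -> g v @[v --> u^'+] --> g u) -> 0 <= t -> t < 1 ->
  dyadic_step g n t @[n --> \oo] --> g t.
Proof.
move=> rg t0 t1; under eq_fun do rewrite dyadic_stepE//.
have tv n := dyadic_upper n t0.
have /cvg_at_rightP := rg t t0; apply; split => [n|].
  by case/andP: (tv n).
apply/cvgrPdist_le => e e0.
have := @dyadic_cvg0 R => /cvgrPdist_le /(_ e e0); apply: filterS => n.
rewrite sub0r normrN gtr0_norm ?dyadic_pos// => ne.
have /andP[tv1 tv2] := tv n.
rewrite distrC ger0_norm ?subr_ge0 ?(ltW tv1)// lerBlDl (le_trans tv2)//.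
by rewrite lerD2l.
Qed.

Lemma dyadic_mean_cvg {R : realType} (g : R -> R) (M : R) :
  (forall t, 0 <= t -> `|g t| <= M) -> (forall u, 0 <= u -> g v @[v --> u^'+] --> g u) ->
  dyadic_mean g n @[n --> \oo] --> \int[lebesgue_measure]_(t in `[0, 1[) g t.
Proof.
move=> gM rg.
have mstep n (D : set R) : measurable_fun D (dyadic_step g n).
  rewrite /dyadic_step.
  apply: measurable_sum => k; apply: measurable_funM; first exact: measurable_cst.
  by apply: measurable_indic; exact: measurable_itv.
have -> : dyadic_mean g = (fun n => \int[lebesgue_measure]_(t in `[0, 1[) dyadic_step g n t).
  apply/funext => n; rewrite /dyadic_step /dyadic_mean.
  have ik (k : 'I_(2 ^ n)) : lebesgue_measure.-integrable
      (`[0, 1[%classic : set R)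
      (EFin \o \1_(`[k%:R * 2 ^- n, k.+1%:R * 2 ^- n[)).
    apply: (integrable_bounded (M := 1)) => //=.
    - by rewrite lebesgue_measure_itv/= lte_fin ltr01 oppr0 addr0 ltry.
    - by move=> x _; rewrite indicE; case: (_ \in _); rewrite ?normr1 ?normr0.
  rewrite Rintegral_sum//=; last by move=> k; apply: integrableZl (ik k).
  rewrite mulr_sumr; apply: eq_bigr => k _.
  rewrite RintegralZl// mulrC; congr (_ * _); rewrite /Rintegral.
  rewrite integral_indic//= setIidl.
    rewrite lebesgue_measure_itv/= lte_fin ltr_pM2r ?dyadic_pos// ltr_nat ltnSn.
    by rewrite -EFinB/= -mulrBl -natrB// subSnn mul1r.
  move=> t /=; rewrite !in_itv/= => /andP[t1 t2]; apply/andP; split.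
    by rewrite (le_trans _ t1)// mulr_ge0// ltW// dyadic_pos.
  rewrite (lt_le_trans t2)// ler_pdivrMr ?exprn_gt0// mul1r -natrX ler_nat.
  exact: ltn_ord.
apply: (bounded_cvg_Rintegral (M := M)) => //=.
- by rewrite lebesgue_measure_itv/= lte_fin ltr01 oppr0 addr0 ltry.
- by move=> n; exact: mstep.
- move=> n t /=; rewrite in_itv/= => /andP[t0 t1]; rewrite dyadic_stepE//.
  by apply: gM; rewrite mulr_ge0// ltW// dyadic_pos.
- by move=> t; rewrite in_itv/= => /andP[t0 t1]; exact: dyadic_step_cvg.
Qed.

Lemma right_continuous_measurable {R : realType} (g : R -> R) :
  (forall u, 0 <= u -> g v @[v --> u^'+] --> g u) -> measurable_fun (`[0, 1[ : set R) g.
Proof.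
move=> rg; apply: (@measurable_fun_cvg _ _ _ _ (dyadic_step g)).
  move=> n; apply: measurable_sum => k; apply: measurable_funM; first exact: measurable_cst.
  by apply: measurable_indic; exact: measurable_itv.
by move=> t /=; rewrite in_itv/= => /andP[t0 t1]; exact: dyadic_step_cvg.
Qed.

(* Shifting a dyadic mean by [j] grid steps changes at most [2 j] of its terms,
   and the two groups of terms have opposite signs. *)
Lemma dyadic_mean_shift {R : realType} (g : R -> R) (n m j : nat) :
  (forall t, 0 <= t -> 0 <= g t <= 1) -> (m <= n)%N ->
  `|dyadic_mean (fun t => g (j%:R * 2 ^- m + t)) n - dyadic_mean g n|
    <= j%:R * 2 ^- m.
Proof.
move=> g01 mn; rewrite /dyadic_mean -mulrBr normrM gtr0_norm ?dyadic_pos//.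
pose a k := g (k.+1%:R * 2 ^- n).
(* A shift by [j] cells of level [m] is a shift by [J] cells of the finer level [n]. *)
pose J := (j * 2 ^ (n - m))%N.
have jJ : j%:R * 2 ^- m = J%:R * 2 ^- n :> R.
  rewrite /J natrM natrX -[in RHS](subnK mn) exprD addnK.
  by field; rewrite !expf_neq0.
rewrite [in leRHS]jJ mulrC ler_pM2r ?dyadic_pos//.
rewrite (_ : \sum_(k < 2 ^ n) g (j%:R * 2 ^- m + k.+1%:R * 2 ^- n)
  = \sum_(J <= k < J + 2 ^ n) a k); last first.
  rewrite -{1}(add0n J) big_addn addKn big_mkord; apply: eq_bigr => k _.
  by rewrite /a jJ -mulrDl -natrD addnC addSn.
rewrite (_ : \sum_(k < 2 ^ n) g (k.+1%:R * 2 ^- n) = \sum_(0 <= k < 2 ^ n) a k);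
  last by rewrite big_mkord.
have a01 k : 0 <= a k <= 1 by apply: g01; rewrite mulr_ge0// ltW// dyadic_pos.
have bnd p q : 0 <= \sum_(p <= k < p + q) a k <= q%:R.
  apply/andP; split; first by apply: sumr_ge0 => k _; case/andP: (a01 k).
  rewrite (le_trans (ler_sum_nat (G := fun=> 1) _))//.
    by move=> k _; case/andP: (a01 k).
  by rewrite sumr_const_nat addKn.
(* The range from 0 to [J + 2 ^ n] is split in two ways, so the two means differ by a difference of
   two sums of [J] terms in [0, 1]. *)
have E : \sum_(0 <= k < J) a k + \sum_(J <= k < J + 2 ^ n) a k =
   \sum_(0 <= k < 2 ^ n) a k + \sum_(2 ^ n <= k < 2 ^ n + J) a k.
  rewrite -big_cat_nat//=; last exact: leq_addr.
  by rewrite -big_cat_nat//=; [rewrite addnC|exact: leq_addr].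
have /andP[b1 b2] := bnd 0%N J; rewrite add0n in b1 b2.
have /andP[c1 c2] := bnd (2 ^ n)%N J.
by rewrite ler_norml; apply/andP; split; lra.
Qed.

(** Plays the part of Fubini's theorem: expectation and time average are exchanged for finite sums,
    by linearity, and the limit in [n] is taken afterwards. *)
Lemma Rintegral_dyadic_mean d (T : measurableType d) (R : realType)
    (mu : {measure set T -> \bar R}) (D : set T) (k : R -> T -> R) (M : R) n :
  measurable D -> (mu D < +oo)%E -> (forall t, 0 <= t -> measurable_fun D (k t)) ->
  (forall t x, 0 <= t -> D x -> `|k t x| <= M) ->
  \int[mu]_(x in D) dyadic_mean (k ^~ x) n =
  dyadic_mean (fun t => \int[mu]_(x in D) k t x) n.
Proof.
move=> mD muD mk kM; rewrite /dyadic_mean.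
have p (i : 'I_(2 ^ n)) : 0 <= i.+1%:R * 2 ^- n :> R by rewrite mulr_ge0// ltW// dyadic_pos.
have ik (i : 'I_(2 ^ n)) : mu.-integrable D (EFin \o k (i.+1%:R * 2 ^- n)).
  by apply: (integrable_bounded (M := M)) => //; [exact: mk|move=> x; exact: kM].
rewrite RintegralZl//; last first.
  apply: (integrable_bounded (M := \sum_(i < 2 ^ n) M)) => //=.
    by apply: measurable_sum => i; exact: mk.
  move=> x Dx; rewrite (le_trans (ler_norm_sum _ _ _))// ler_sum// => i _.
  exact: kM.
by rewrite Rintegral_sum.
Qed.

Lemma dyadic_mean_bound (R : realType) (g : R -> R) n :
  (forall t, 0 <= t -> 0 <= g t <= 1) -> 0 <= dyadic_mean g n <= 1.
Proof.
move=> g01; rewrite /dyadic_mean.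
have h (i : 'I_(2 ^ n)) : 0 <= g (i.+1%:R * 2 ^- n) <= 1.
  by apply: g01; rewrite mulr_ge0// ltW// dyadic_pos.
apply/andP; split.
  rewrite mulr_ge0 ?(ltW (dyadic_pos _))//.
  by apply: sumr_ge0 => i _; case/andP: (h i).
rewrite ler_pdivrMl ?exprn_gt0// mulr1.
have : \sum_(i < 2 ^ n) g (i.+1%:R * 2 ^- n) <= \sum_(i < 2 ^ n) 1.
  by apply: ler_sum => i _; case/andP: (h i).
by rewrite sumr_const card_ord natrX.
Qed.

Lemma eq_dyadic_mean (R : realType) (g g' : R -> R) n :
  (forall t, 0 <= t -> g t = g' t) -> dyadic_mean g n = dyadic_mean g' n.
Proof.
move=> gg'; rewrite /dyadic_mean; congr (_ * _); apply: eq_bigr => i _.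
by apply: gg'; rewrite mulr_ge0// ltW// dyadic_pos.
Qed.

(* Layer-cake formula for [0 <= a <= 1], in the form of Riemann sums. *)
Lemma dyadic_mean_layer_cake (R : realType) (a : R) : 0 <= a <= 1 ->
  dyadic_mean (fun t => \1_[set u | u < a] t) n @[n --> \oo] --> a.
Proof.
move=> /andP[a0 a1].
have := @dyadic_mean_cvg R (fun t => \1_[set u | u < a] t) 1.
have -> : \int[lebesgue_measure]_(t in `[0, 1[) \1_[set u : R | u < a] t = a.
  rewrite /Rintegral integral_indic//; last first.
    by rewrite -set_itvNyo; exact: measurable_itv.
  rewrite (_ : _ `&` _ = `[0, a[%classic); last first.
    apply/seteqP; split => t /=; rewrite !in_itv/=.
      by move=> [-> /andP[->]].
    by move=> /andP[-> ta]; rewrite ta (lt_le_trans ta).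
  have := @lebesgue_measure_itv R `[0, a[ => /= ->; rewrite lte_fin.
  case: ltP => //= [_|a0']; first by rewrite subr0.
  by apply/eqP; rewrite eq_le a0 a0'.
apply.
- by move=> t _; rewrite indicE; case: (_ \in _); rewrite ?normr1 ?normr0.
- move=> t _; apply: cvg_near_cst; rewrite indicE.
  have [ta|at_] := ltP t a.
    rewrite (_ : (t \in _) = true) ?mem_set//; apply: filterS (nbhs_right_lt ta) => u ua.
    by rewrite indicE mem_set.
  rewrite (_ : (t \in _) = false); last by apply: memNset; apply/negP; rewrite -leNgt.
  apply: filterS (nbhs_right_ge t) => u tu.
  by rewrite indicE memNset//=; apply/negP; rewrite -leNgt (le_trans at_).
Qed.

Lemma measurable_continuous (R : realType) (E : pointedMetricType R) (h : E -> R) :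
  continuous h -> measurable_fun setT (h : borel E -> R).
Proof.
move=> ch; apply: (measurability _ (RGenOInfty.measurableE R)).
move=> _ [_ [a ->] <-]; rewrite setTI; apply: sub_sigma_algebra.
by apply: open_comp => //; rewrite -set_itvoy; exact: interval_open.
Qed.

(** * Markov property of the semigroup *)

Section Markov.
Context (R : realType) (E : pointedMetricType R) (d : measure_display)
  (Omega : measurableType d) (F : R -> set (set Omega)) (X : R -> Omega -> E)
  (P : E -> probability Omega R) (Xstd : standard_markov_process F X P).

Lemma filtration_sigma (t : R) : 0 <= t -> sigma_algebra setT (F t).
Proof. by case: (smp_filtration Xstd) => + _ _; apply. Qed.

Lemma filtration_measurable (t : R) : 0 <= t -> F t `<=` measurable.
Proof. by case: (smp_filtration Xstd) => _ + _; apply. Qed.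

Lemma filtration_le (s t : R) : 0 <= s -> s <= t -> F s `<=` F t.
Proof. by case: (smp_filtration Xstd) => _ _; apply. Qed.

Lemma filtration_setT (t : R) : 0 <= t -> F t setT.
Proof.
by move=> t0; have [f0 fC _] := filtration_sigma t0; rewrite -(setD0 setT); exact: fC.
Qed.

Lemma measurable_state (t : R) : 0 <= t -> measurable_fun setT (X t : Omega -> borel E).
Proof.
move=> t0 _ B mB; rewrite setTI; apply: (filtration_measurable t0).
exact: (smp_adapted Xstd).
Qed.

Lemma measurable_state_comp (t : R) (h : E -> R) : 0 <= t ->
  measurable_fun setT (h : borel E -> R) -> measurable_fun setT (fun w => h (X t w)).
Proof. by move=> t0 mh; exact: (measurableT_comp mh (measurable_state t0)). Qed.

Lemma prob_fin_num x (A : set Omega) : measurable A -> P x A \is a fin_num.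
Proof. by move=> mA; exact: fin_num_measure. Qed.

Lemma prob_lty x (A : set Omega) : measurable A -> (P x A < +oo)%E.
Proof. by move=> mA; rewrite (le_lt_trans (probability_le1 _ mA))// ltry. Qed.

Lemma Rintegral_prob x (r : R) : \int[P x]_w r = r.
Proof.
rewrite Rintegral_cst//; set p := (X in fine X).
by rewrite (_ : p = 1%E) ?mulr1//; exact: (probability_setT (P x)).
Qed.

Lemma Rintegral_indic_comp x (A : set Omega) t (B : set (borel E)) :
  measurable A -> 0 <= t -> measurable B ->
  \int[P x]_(w in A) \1_B (X t w) = fine (P x (A `&` X t @^-1` B)).
Proof.
move=> mA t0 mB; rewrite /Rintegral setIC -integral_indic//.
by rewrite -[X in measurable X]setTI; exact: measurable_state.
Qed.

(** This is the strong Markov property at the constant stopping time [s], which is finite, so that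
    the event of finiteness drops out. *)
Lemma strong_markov_cst x (s t : R) (A : set Omega) (B : set (borel E)) :
  0 <= s -> 0 <= t -> F s A -> measurable B ->
  \int[P x]_(w in A) fine (P (X s w) (X t @^-1` B)) =
  fine (P x (A `&` X (s + t) @^-1` B)).
Proof.
move=> s0 t0 FA mB.
have mXB : measurable (X t @^-1` B).
  by rewrite -[X in measurable X]setTI; exact: measurable_state.
have st : stopping_time F (fun=> s%:E).
  split => [w|u u0]; first by rewrite lee_fin.
  have [su|su] := leP s u.
    rewrite (_ : [set w | _] = setT); first exact: filtration_setT.
    by apply/seteqP; split => // w _ /=; rewrite lee_fin.
  rewrite (_ : [set w | _] = set0); first by case: (filtration_sigma u0).
  by apply/seteqP; split => // w /=; rewrite lee_fin leNgt su.
have sA : stopped_sigma F (fun=> s%:E) A.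
  split => [|u u0]; first exact: (filtration_measurable s0).
  have [su|su] := leP s u.
    rewrite (_ : _ `&` _ = A); first exact: (filtration_le s0 su).
    by apply/seteqP; split => [w []//|w Aw] /=; rewrite lee_fin.
  rewrite (_ : _ `&` _ = set0); first by case: (filtration_sigma u0).
  by apply/seteqP; split => // w [] _ /=; rewrite lee_fin leNgt su.
have := smp_strong_markov Xstd x st sA t0 mB.
rewrite (_ : A `&` [set w | _] = A) /=; last first.
  by apply/seteqP; split => [w []//|w Aw] /=; rewrite ltry.
move=> ->; rewrite /Rintegral; congr fine; apply: eq_integral => w _.
by rewrite fineK// prob_fin_num.
Qed.

(** The layer-cake sums of [h (X t w)] are integrated by bounded convergence. This transfers facts
    on transition probabilities of sets to functions with values in [0, 1]. *)
Lemma semigroup_layer_cake (t : R) (h : E -> R) z : 0 <= t ->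
  measurable_fun setT (h : borel E -> R) -> (forall y, 0 <= h y <= 1) ->
  dyadic_mean (fun u => fine (P z (X t @^-1` [set y | u < h y]))) n @[n --> \oo]
    --> semigroup X P t h z.
Proof.
move=> t0 mh h01.
have mB u : measurable ([set y | u < h y] : set (borel E)).
  rewrite -[X in measurable X]setTI (_ : [set y | u < h y] = h @^-1` `]u, +oo[%classic).
    by apply: mh => //; exact: measurable_itv.
  by apply/seteqP; split => y /=; rewrite in_itv/= andbT.
have := @bounded_cvg_Rintegral _ _ _ (P z) setT
  (fun n w => dyadic_mean (fun u => \1_[set y | u < h y] (X t w)) n) (fun w => h (X t w)) 1.
have E1 n : \int[P z]_w dyadic_mean (fun u => \1_[set y | u < h y] (X t w)) n =
    dyadic_mean (fun u => fine (P z (X t @^-1` [set y | u < h y]))) n.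
  rewrite (@Rintegral_dyadic_mean _ _ _ _ _ (fun u w => \1_[set y | u < h y] (X t w)) 1)//.
  - apply: eq_dyadic_mean => u u0.
    by rewrite Rintegral_indic_comp// setTI.
  - exact: prob_lty.
  - move=> u u0; apply: (measurable_state_comp t0).
    exact: measurable_indic.
  - by move=> u w _ _; rewrite indicE; case: (_ \in _); rewrite ?normr1 ?normr0.
under eq_fun do rewrite E1; apply => //.
- exact: prob_lty.
- move=> n; rewrite /dyadic_mean; apply: measurable_funM; first exact: measurable_cst.
  apply: measurable_sum => k; apply: (measurable_state_comp t0).
  exact: measurable_indic.
- move=> n w _.
  have /andP[m0 m1] : 0 <= dyadic_mean (fun u => \1_[set y | u < h y] (X t w)) n <= 1.
    apply: dyadic_mean_bound => u _.
    by rewrite indicE; case: (_ \in _); rewrite ?ler01 ?lexx.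
  by rewrite ger0_norm.
- by move=> w _; exact: (dyadic_mean_layer_cake (h01 (X t w))).
Qed.

Lemma semigroup_bound (t : R) (h : E -> R) z : 0 <= t ->
  measurable_fun setT (h : borel E -> R) -> (forall y, 0 <= h y <= 1) ->
  0 <= semigroup X P t h z <= 1.
Proof.
move=> t0 mh h01; apply/andP; split.
  by apply: Rintegral_ge0 => w _; case/andP: (h01 (X t w)).
rewrite (le_trans (le_Rintegral (f2 := fun=> 1) measurableT _ _ _))//.
- apply: (integrable_bounded (M := 1)) => //; first exact: prob_lty.
    exact: measurable_state_comp.
  by move=> w _; rewrite ger0_norm; case/andP: (h01 (X t w)).
- by apply: (integrable_bounded (M := 1)) => //; [exact: prob_lty|move=> w _; rewrite normr1].
- by move=> w _; case/andP: (h01 (X t w)).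
- by rewrite Rintegral_prob.
Qed.

Lemma measurable_semigroup (t : R) (h : E -> R) : 0 <= t ->
  measurable_fun setT (h : borel E -> R) -> (forall y, 0 <= h y <= 1) ->
  measurable_fun setT (semigroup X P t h : borel E -> R).
Proof.
move=> t0 mh h01; apply: (@measurable_fun_cvg _ (borel E) R setT
  (fun n z => dyadic_mean (fun u => fine (P z (X t @^-1` [set y | u < h y]))) n)).
  move=> n; apply: measurable_funM; first exact: measurable_cst.
  apply: measurable_sum => k.
  apply: (measurableT_comp (f := fine)) => //.
  apply: (smp_transition_measurable Xstd) => //.
  rewrite -[X in measurable X]setTI.
  rewrite (_ : [set y | _ < h y] =
    h @^-1` `](k.+1%:R * 2 ^- n), +oo[%classic).
    by apply: mh => //; exact: measurable_itv.
  by apply/seteqP; split => y /=; rewrite in_itv/= andbT.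
by move=> z _; exact: semigroup_layer_cake.
Qed.

(** Both sides are limits of the same sequence [L]: layer cake reduces [h] to its superlevel sets,
    for which [strong_markov_cst] gives the equality. *)
Lemma markov_property x (s t : R) (A : set Omega) (h : E -> R) :
  0 <= s -> 0 <= t -> F s A ->
  measurable_fun setT (h : borel E -> R) -> (forall y, 0 <= h y <= 1) ->
  \int[P x]_(w in A) semigroup X P t h (X s w) =
  \int[P x]_(w in A) h (X (s + t) w).
Proof.
move=> s0 t0 FA mh h01; have mA := filtration_measurable s0 FA.
have st0 : 0 <= s + t by rewrite addr_ge0.
have mB u : measurable ([set y | u < h y] : set (borel E)).
  rewrite -[X in measurable X]setTI (_ : [set y | u < h y] = h @^-1` `]u, +oo[%classic).
    by apply: mh => //; exact: measurable_itv.
  by apply/seteqP; split => y /=; rewrite in_itv/= andbT.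
have mXB u : measurable (X t @^-1` [set y | u < h y]).
  by rewrite -[X in measurable X]setTI; exact: measurable_state.
have f01 u z : 0 <= fine (P z (X t @^-1` [set y | u < h y])) <= 1.
  rewrite fine_ge0//= -lee_fin fineK ?prob_fin_num//.
  exact: probability_le1.
have i01 u z : 0 <= (\1_[set y | u < h y] z : R) <= 1.
  by rewrite indicE; case: (_ \in _); rewrite ?ler01 ?lexx.
have b1 (a : R) : 0 <= a <= 1 -> `|a| <= 1 by move=> /andP[a0 a1]; rewrite ger0_norm.
have mf u : measurable_fun setT
    ((fun z => fine (P z (X t @^-1` [set y | u < h y]))) : borel E -> R).
  apply: (measurableT_comp (f := fine)) => //.
  exact: (smp_transition_measurable Xstd).
pose L n := dyadic_mean (fun u => fine (P x (A `&` X (s + t) @^-1` [set y | u < h y]))) n.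
have cv1 : L n @[n --> \oo] --> \int[P x]_(w in A) semigroup X P t h (X s w).
  have E1 n : L n = \int[P x]_(w in A)
      dyadic_mean (fun u => fine (P (X s w) (X t @^-1` [set y | u < h y]))) n.
    rewrite (@Rintegral_dyadic_mean _ _ _ _ _
      (fun u w => fine (P (X s w) (X t @^-1` [set y | u < h y]))) 1)//.
    - by apply: eq_dyadic_mean => u u0; rewrite strong_markov_cst.
    - exact: prob_lty.
    - by move=> u u0; apply: measurable_funTS; exact: (measurable_state_comp s0 (mf u)).
    - by move=> u w _ _; exact: b1.
  under eq_fun do rewrite E1.
  apply: (bounded_cvg_Rintegral (M := 1)) => //.
  - exact: prob_lty.
  - move=> n; apply: measurable_funTS; apply: measurable_funM; first exact: measurable_cst.
    by apply: measurable_sum => k; exact: (measurable_state_comp s0 (mf _)).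
  - by move=> n w _; apply: b1; exact: dyadic_mean_bound.
  - by move=> w _; exact: semigroup_layer_cake.
have cv2 : L n @[n --> \oo] --> \int[P x]_(w in A) h (X (s + t) w).
  have E2 n : L n = \int[P x]_(w in A)
      dyadic_mean (fun u => \1_[set y | u < h y] (X (s + t) w)) n.
    rewrite (@Rintegral_dyadic_mean _ _ _ _ _
      (fun u w => \1_[set y | u < h y] (X (s + t) w)) 1)//.
    - by apply: eq_dyadic_mean => u u0; rewrite Rintegral_indic_comp.
    - exact: prob_lty.
    - move=> u u0; apply: measurable_funTS; apply: (measurable_state_comp st0).
      exact: measurable_indic.
    - by move=> u w _ _; exact: b1.
  under eq_fun do rewrite E2.
  apply: (bounded_cvg_Rintegral (M := 1)) => //.
  - exact: prob_lty.
  - move=> n; apply: measurable_funTS; apply: measurable_funM; first exact: measurable_cst.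
    by apply: measurable_sum => k; apply: (measurable_state_comp st0); exact: measurable_indic.
  - by move=> n w _; apply: b1; exact: dyadic_mean_bound.
  - by move=> w _; exact: (dyadic_mean_layer_cake (h01 (X (s + t) w))).
exact: (cvg_unique _ cv1 cv2).
Qed.

Lemma semigroupD (s t : R) (h : E -> R) z : 0 <= s -> 0 <= t ->
  measurable_fun setT (h : borel E -> R) -> (forall y, 0 <= h y <= 1) ->
  semigroup X P s (semigroup X P t h) z = semigroup X P (s + t) h z.
Proof.
by move=> s0 t0 mh h01; apply: markov_property => //; exact: filtration_setT.
Qed.

(** Normality, recast as a measurable null set; singletons are Borel because they are closed in a
    metric space. *)
Lemma state0_null z : exists N : set Omega,
  [/\ measurable N, P z N = 0%E & forall w, ~ N w -> X 0 w = z].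
Proof.
have mz : measurable (X 0 @^-1` ([set z] : set (borel E))).
  rewrite -[X in measurable X]setTI; apply: measurable_state => //.
  rewrite -[X in measurable X]setCK; apply: measurableC; apply: sub_sigma_algebra.
  apply: closed_openC; apply: accessible_closed_set1; apply: hausdorff_accessible.
  exact: metric_hausdorff.
exists (~` (X 0 @^-1` [set z])); split; first exact: measurableC.
  by rewrite probability_setC// (smp_normal Xstd) subee.
by move=> w /contrapT.
Qed.

Lemma semigroup0 (h : E -> R) z :
  measurable_fun setT (h : borel E -> R) -> (forall y, 0 <= h y <= 1) ->
  semigroup X P 0 h z = h z.
Proof.
move=> mh h01; have [N [mN N0 HN]] := state0_null z.
rewrite /semigroup -[RHS](Rintegral_prob z) /Rintegral; congr fine.
apply: ae_eq_integral => //.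
- by apply/measurable_EFinP; exact: measurable_state_comp.
- exists N; split => // w; apply: contra_notP => Nw _.
  by rewrite /= HN.
Qed.

Lemma state_cvg (t : R) (u : nat -> R) w : 0 <= t -> (forall n, t < u n) ->
  u n @[n --> \oo] --> t -> X (u n) w @[n --> \oo] --> X t w.
Proof.
move=> t0 tu ut; have [rc _] := smp_cadlag Xstd w.
apply: (cvg_comp u (X ^~ w) _ (rc t t0)) => A [e e0 eA].
by move/cvgrPdist_lt: ut => /(_ e e0); apply: filterS => n nt; apply: eA.
Qed.

Lemma semigroup_right_continuous (t : R) (h : E -> R) z : 0 <= t ->
  continuous h -> (forall y, 0 <= h y <= 1) ->
  semigroup X P u h z @[u --> t^'+] --> semigroup X P t h z.
Proof.
move=> t0 ch h01; apply/cvg_at_rightP => u [tu ut].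
have u0 n : 0 <= u n by rewrite (le_trans t0)// ltW.
apply: (bounded_cvg_Rintegral (M := 1)) => //.
- exact: prob_lty.
- by move=> n; apply: measurable_state_comp => //; exact: measurable_continuous.
- by move=> n w _; rewrite ger0_norm; case/andP: (h01 (X (u n) w)).
- move=> w _; apply: continuous_cvg; first exact: ch.
  exact: state_cvg.
Qed.

End Markov.

(** * Functions on metric spaces *)

Section MetricFunctions.
Context (R : realType) (E : pointedMetricType R).

Lemma nbhs_mdist (z : E) (A : set E) :
  (exists2 e : R, 0 < e & forall y, mdist z y < e -> A y) -> nbhs z A.
Proof.
move=> [e e0 eA]; apply/nbhs_ballP; exists e => // y.
by rewrite ballEmdist; exact: eA.
Qed.

Lemma nbhs_mdist_lt (z : E) (e : R) : 0 < e -> \forall y \near z, mdist z y < e.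
Proof. by move=> e0; apply: nbhs_mdist; exists e. Qed.

Lemma cvg_mdistP (v : nat -> E) (z : E) :
  (forall e : R, 0 < e -> \forall n \near \oo, mdist z (v n) < e) ->
  v n @[n --> \oo] --> z.
Proof.
move=> h A /nbhs_ballP[e e0 eA].
apply: filterS (h e e0) => n zn; apply: eA; rewrite ballEmdist; exact: zn.
Qed.

Lemma cvg_mdist_lt (T : Type) (A : set_system T) {FA : Filter A} (v : T -> E) (z : E) (e : R) :
  v n @[n --> A] --> z -> 0 < e -> \forall n \near A, mdist z (v n) < e.
Proof. by move=> vz e0; exact: (vz _ (nbhs_mdist_lt z e0)). Qed.

(** Sequences suffice in a metric space, and they are what bounded convergence handles. *)
Lemma continuous_seq (h : E -> R) :
  (forall (z : E) (v : nat -> E), v n @[n --> \oo] --> z ->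
     h (v n) @[n --> \oo] --> h z) -> continuous h.
Proof.
move=> hseq z; apply/cvgrPdist_lt => e e0.
apply: contrapT => hn.
have H n : exists y, mdist z y < 2 ^- n /\ ~ (`|h z - h y| < e).
  apply: contrapT => /forallNP hn'; apply: hn; apply: nbhs_mdist.
  exists (2 ^- n); first exact: dyadic_pos.
  by move=> y zy; apply: contrapT => yh; apply: (hn' y).
have [v hv] := choice H.
have vz : v n @[n --> \oo] --> z.
  apply: cvg_mdistP => a a0.
  have /cvgrPdist_lt/(_ a a0) := @dyadic_cvg0 R; apply: filterS => n.
  rewrite sub0r normrN gtr0_norm ?dyadic_pos//; apply: lt_trans.
  by case: (hv n).
have /cvgrPdist_lt/(_ e e0) := hseq z v vz.
by move=> [n _ /(_ n (leqnn n))]; case: (hv n).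
Qed.

Lemma mdist_continuous (z : E) : continuous (mdist z : E -> R).
Proof.
move=> y; apply/cvgrPdist_lt => e e0.
apply: filterS (nbhs_mdist_lt y e0) => y' yy'.
rewrite ltr_norml; have h1 := metric_triangle z y y'; have h2 := metric_triangle z y' y.
rewrite (metric_sym y' y) in h2.
by apply/andP; split; lra.
Qed.

Lemma open_mdist_lt (z : E) (r : R) : open [set y | mdist z y < r].
Proof.
rewrite (_ : [set y | _] = mdist z @^-1` `]-oo, r[%classic); last first.
  by apply/seteqP; split => y /=; rewrite in_itv.
by apply: open_comp => [y _|]; [exact: mdist_continuous|exact: interval_open].
Qed.

Lemma open_mdist_gt (z : E) (r : R) : open [set y | r < mdist z y].
Proof.
rewrite (_ : [set y | _] = mdist z @^-1` `]r, +oo[%classic); last first.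
  by apply/seteqP; split => y /=; rewrite in_itv/= andbT.
by apply: open_comp => [y _|]; [exact: mdist_continuous|exact: interval_open].
Qed.

Lemma compact_mdist_bounded (z : E) (K : set E) : compact K ->
  exists N : nat, forall y, K y -> mdist z y <= N%:R.
Proof.
move=> cK; have cd : {within K, continuous (mdist z : E -> R)}.
  by apply: continuous_subspaceT; exact: mdist_continuous.
have /compact_bounded[M [_ HM]] := continuous_compact cd cK.
have [n Mn] : exists n : nat, M < n%:R.
  by exists (Num.bound `|M|); rewrite (le_lt_trans (ler_norm M))// archi_boundP.
exists n => y Ky; have /= := HM _ Mn (mdist z y) (imageP _ Ky).
exact/le_trans/ler_norm.
Qed.

Lemma C0_far (h : E -> R) (z : E) (v : nat -> E) : C0 h ->
  (forall n, n%:R < mdist z (v n)) -> h (v n) @[n --> \oo] --> 0.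
Proof.
move=> [_ hK] vn; apply/cvgrPdist_lt => e e0.
have [K cK Ke] := hK e e0; have [N HN] := compact_mdist_bounded z cK.
exists N => // n /= Nn; rewrite sub0r normrN; apply: Ke => /HN.
by apply/negP; rewrite -ltNge (le_lt_trans _ (vn n))// ler_nat.
Qed.

(** Closed balls around [z] serve as the compact sets of [C0]; if all of them failed for some [e],
    choosing one bad point outside each would give a sequence escaping to infinity. *)
Lemma C0_seq (h : E -> R) (z : E) : closed_balls_compact E -> Cb h ->
  (forall v : nat -> E, (forall n, n%:R < mdist z (v n)) ->
    h (v n) @[n --> \oo] --> 0) -> C0 h.
Proof.
move=> Ec hC hv; split => // e e0; apply: contrapT => hn.
have H n : exists y, n%:R < mdist z y /\ ~ (`|h y| < e).
  apply: contrapT => /forallNP hn'; apply: hn.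
  exists [set y | mdist z y <= n%:R]; first exact: Ec.
  move=> y /negP; rewrite -ltNge => zy; apply: contrapT => yh; exact: (hn' y).
have [v hvv] := choice H.
have /hv/cvgrPdist_lt/(_ e e0)[n _ /(_ n (leqnn n))] : forall n, n%:R < mdist z (v n).
  by move=> n; case: (hvv n).
by rewrite /= sub0r normrN; case: (hvv n).
Qed.

Definition bump (x : E) (r : R) (y : E) : R := Num.max 0 (1 - mdist x y / r).

Lemma bump_bound (x : E) (r : R) (y : E) : 0 < r -> 0 <= bump x r y <= 1.
Proof.
move=> r0; rewrite /bump le_max lexx/= ge_max ler01/= gerBl.
by rewrite divr_ge0 ?mdist_ge0// ltW.
Qed.

Lemma bump_center (x : E) (r : R) : bump x r x = 1.
Proof. by rewrite /bump mdistxx mul0r subr0; apply/max_idPr. Qed.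

Lemma bump_far (x : E) (r : R) (y : E) : 0 < r -> r <= mdist x y -> bump x r y = 0.
Proof.
move=> r0 ry; rewrite /bump; apply/max_idPl.
by rewrite subr_le0 ler_pdivlMr// mul1r.
Qed.

Lemma bump_continuous (x : E) (r : R) : continuous (bump x r).
Proof.
move=> y; apply: (@continuous_max _ _ (cst 0) (fun z => 1 - mdist x z / r)).
  exact: cvg_cst.
apply: cvgB; first exact: cvg_cst.
by apply: cvgM; [exact: mdist_continuous|exact: cvg_cst].
Qed.

Lemma Cb_intro (h : E -> R) (M : R) : continuous h -> (forall y, `|h y| <= M) -> Cb h.
Proof.
move=> ch hM; split => //; exists M; split; first exact: num_real.
by move=> a Ma y _ /=; rewrite (le_trans (hM y))// ltW.
Qed.

Lemma bump_C0 (x : E) (r : R) : closed_balls_compact E -> 0 < r -> C0 (bump x r).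
Proof.
move=> Ec r0; split.
  apply: (@Cb_intro _ 1); first exact: bump_continuous.
  by move=> y; have /andP[h0 h1] := bump_bound x y r0; rewrite ger0_norm.
move=> e e0; exists [set y | mdist x y <= r]; first exact: Ec.
by move=> y /negP; rewrite -ltNge => ry; rewrite bump_far ?normr0// ltW.
Qed.

End MetricFunctions.

(** * Time averages of the semigroup *)

Section TimeAverage.
Context (R : realType) (E : pointedMetricType R) (d : measure_display)
  (Omega : measurableType d) (F : R -> set (set Omega)) (X : R -> Omega -> E)
  (P : E -> probability Omega R) (Xstd : standard_markov_process F X P)
  (Ec : closed_balls_compact E) (Xfeller : weakly_feller X P).

(** This is the mean of [P_s h] over [s] in [0, r[, rescaled to the unit interval so that the dyadic
    sums apply for every [r]. *)
Definition time_average (r : R) (h : E -> R) (z : E) : R :=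
  \int[lebesgue_measure]_(t in `[0, 1[) semigroup X P (r * t) h z.

Lemma semigroup_scaled_right_continuous (r : R) (h : E -> R) (z : E) : 0 < r ->
  continuous h -> (forall y, 0 <= h y <= 1) ->
  forall u, 0 <= u -> semigroup X P (r * v) h z @[v --> u^'+] --> semigroup X P (r * u) h z.
Proof.
move=> r0 ch h01 u u0; apply/cvg_at_rightP => v [uv vu].
have ru0 : 0 <= r * u by rewrite mulr_ge0// ltW.
have /cvg_at_rightP := semigroup_right_continuous Xstd (z := z) ru0 ch h01.
apply; split => [n|]; first by rewrite ltr_pM2l.
by apply: cvgM => //; exact: cvg_cst.
Qed.

Lemma measurable_semigroup_time (r : R) (h : E -> R) (z : E) : 0 < r ->
  continuous h -> (forall y, 0 <= h y <= 1) ->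
  measurable_fun (`[0, 1[ : set R) (fun t => semigroup X P (r * t) h z).
Proof.
move=> r0 ch h01; apply: right_continuous_measurable => u u0.
exact: semigroup_scaled_right_continuous.
Qed.

Lemma normr_semigroup_le1 (t : R) (h : E -> R) (z : E) : 0 <= t -> continuous h ->
  (forall y, 0 <= h y <= 1) -> `|semigroup X P t h z| <= 1.
Proof.
move=> t0 ch h01.
by have /andP[? ?] := semigroup_bound Xstd z t0 (measurable_continuous ch) h01; rewrite ger0_norm.
Qed.

Lemma lebesgue_itv01_lty : (lebesgue_measure (`[0%R, 1%R[%classic : set R) < +oo)%E.
Proof. by rewrite lebesgue_measure_itv/= lte_fin ltr01 oppr0 addr0 ltry. Qed.

Lemma time_average_bound (r : R) (h : E -> R) (z : E) : 0 < r -> continuous h ->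
  (forall y, 0 <= h y <= 1) -> 0 <= time_average r h z <= 1.
Proof.
move=> r0 ch h01; have rt0 t : `[0, 1[%classic t -> 0 <= r * t.
  by rewrite /= in_itv/= => /andP[t0 _]; rewrite mulr_ge0// ltW.
have sb t : `[0, 1[%classic t -> 0 <= semigroup X P (r * t) h z <= 1.
  by move/rt0 => t0; exact: (semigroup_bound Xstd z t0 (measurable_continuous ch) h01).
apply/andP; split.
  by apply: Rintegral_ge0 => t /sb/andP[].
rewrite (le_trans (le_Rintegral (f2 := fun=> 1) _ _ _ _))//=.
- apply: (integrable_bounded (M := 1)) => //=; first exact: lebesgue_itv01_lty.
    exact: measurable_semigroup_time.
  by move=> t /rt0 t0; exact: normr_semigroup_le1.
- apply: (integrable_bounded (M := 1)) => //=; first exact: lebesgue_itv01_lty.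
  by move=> t _; rewrite normr1.
- by move=> t /sb/andP[].
- by rewrite Rintegral_cst//= lebesgue_measure_itv/= lte_fin ltr01/= subr0 mulr1.
Qed.

(** The limit [l] is left free: it is the semigroup at a point for continuity, and 0 for vanishing
    at infinity. *)
Lemma time_average_cvg (r : R) (h : E -> R) (v : nat -> E) (l : R -> R) : 0 < r -> continuous h ->
  (forall y, 0 <= h y <= 1) ->
  (forall t, 0 <= t -> semigroup X P t h (v n) @[n --> \oo] --> l t) ->
  time_average r h (v n) @[n --> \oo] --> \int[lebesgue_measure]_(t in `[0, 1[) l (r * t).
Proof.
move=> r0 ch h01 hl; have rt0 t : t \in `[0, 1[ -> 0 <= r * t.
  by rewrite in_itv/= => /andP[t0 _]; rewrite mulr_ge0// ltW.
apply: (bounded_cvg_Rintegral (M := 1)) => //=; first exact: lebesgue_itv01_lty.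
- by move=> n; exact: measurable_semigroup_time.
- by move=> n t /rt0 t0; exact: normr_semigroup_le1.
- by move=> t /rt0 t0; exact: hl.
Qed.

Lemma time_average_continuous (r : R) (h : E -> R) : 0 < r -> C0 h ->
  (forall y, 0 <= h y <= 1) -> continuous (time_average r h).
Proof.
move=> r0 hC h01; have ch := hC.1.1; apply: continuous_seq => z v vz.
apply: (time_average_cvg (l := fun t => semigroup X P t h z)) => // t t0.
by apply: continuous_cvg => //; apply: (Xfeller t0 hC).1.1.
Qed.

Lemma time_average_C0 (r : R) (h : E -> R) : 0 < r -> C0 h ->
  (forall y, 0 <= h y <= 1) -> C0 (time_average r h).
Proof.
move=> r0 hC h01; have ch := hC.1.1.
apply: (@C0_seq _ _ _ point) => // [|v hv].
  apply: (@Cb_intro _ _ _ 1); first exact: time_average_continuous.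
  by move=> y; have /andP[? ?] := time_average_bound y r0 ch h01; rewrite ger0_norm.
rewrite (_ : 0 = \int[lebesgue_measure]_(t in (`[0, 1[%classic : set R)) (fun=> 0) (r * t)).
  apply: (time_average_cvg (l := fun=> 0)) => // t t0.
  exact: (C0_far (Xfeller t0 hC) hv).
by rewrite Rintegral_cst//= mul0r.
Qed.

Lemma time_average_cvg0 (h : E -> R) (z : E) : continuous h -> (forall y, 0 <= h y <= 1) ->
  time_average (2 ^- n) h z @[n --> \oo] --> h z.
Proof.
move=> ch h01.
have E1 : \int[lebesgue_measure]_(t in (`[0, 1[%classic : set R)) h z = h z.
  by rewrite Rintegral_cst//= lebesgue_measure_itv/= lte_fin ltr01/= subr0 mulr1.
rewrite -[X in _ --> X]E1; have rt0 n t : t \in `[0, 1[ -> 0 <= 2 ^- n * t :> R.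
  by rewrite in_itv/= => /andP[t0 _]; rewrite mulr_ge0// ltW// dyadic_pos.
apply: (bounded_cvg_Rintegral (M := 1)) => //=; first exact: lebesgue_itv01_lty.
- by move=> n; apply: measurable_semigroup_time => //; exact: dyadic_pos.
- by move=> n t /(rt0 n) t0; exact: normr_semigroup_le1.
move=> t t01; rewrite -[X in _ --> X](semigroup0 Xstd z (measurable_continuous ch) h01).
(* The time [t = 0] is treated apart, since a limit from the right needs the times [2 ^- n * t] to
   be strictly positive. *)
move: t01; rewrite in_itv/= => /andP[]; rewrite le_eqVlt => /predU1P[<- _|t0 _].
  by under eq_fun do rewrite mulr0; exact: cvg_cst.
have /cvg_at_rightP := semigroup_right_continuous Xstd (z := z) (lexx 0) ch h01.
apply; split => [n|]; first by rewrite mulr_gt0// dyadic_pos.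
rewrite -[X in _ --> X](mul0r t); apply: cvgM; last exact: cvg_cst.
exact: dyadic_cvg0.
Qed.

(** With [s = r * (j%:R * 2 ^- m)], applying [P_s] moves the window of averaging from [0, r[ to [s,
    s + r[, which affects a fraction [s / r] of it. At grid times this is [dyadic_mean_shift], at
    every level [n >= m], followed by a limit. *)
Lemma semigroup_time_average (r : R) (h : E -> R) (z : E) m j : 0 < r -> C0 h ->
  (forall y, 0 <= h y <= 1) ->
  `|semigroup X P (r * (j%:R * 2 ^- m)) (time_average r h) z - time_average r h z|
    <= j%:R * 2 ^- m.
Proof.
move=> r0 hC h01; have ch := hC.1.1.
have mh := measurable_continuous ch.
have ca := time_average_continuous r0 hC h01.
pose s := r * (j%:R * 2 ^- m).
have s0 : 0 <= s by rewrite !mulr_ge0// ltW// dyadic_pos.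
have rt0 t : 0 <= t -> 0 <= r * t by move=> t0; rewrite mulr_ge0// ltW.
have rc y := semigroup_scaled_right_continuous (z := y) r0 ch h01.
have n1 y t : 0 <= t -> `|semigroup X P (r * t) h y| <= 1.
  by move=> t0; exact: normr_semigroup_le1 (rt0 _ t0) ch h01.
have b01 y t : 0 <= t -> 0 <= semigroup X P (r * t) h y <= 1.
  by move=> t0; exact: (semigroup_bound Xstd y (rt0 _ t0) mh h01).
have c1 : dyadic_mean (fun t => semigroup X P (r * t) h z) n @[n --> \oo] --> time_average r h z.
  exact: (dyadic_mean_cvg (n1 z) (rc z)).
(* By the semigroup property and linearity the shifted dyadic mean is [P_s] applied to the dyadic
   mean; bounded convergence then yields [P_s] of the time average. *)
have c2 : dyadic_mean (fun t => semigroup X P (r * (j%:R * 2 ^- m + t)) h z) n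
    @[n --> \oo] --> semigroup X P s (time_average r h) z.
  have E1 n : dyadic_mean (fun t => semigroup X P (r * (j%:R * 2 ^- m + t)) h z) n =
     \int[P z]_w dyadic_mean (fun t => semigroup X P (r * t) h (X s w)) n.
    rewrite (@Rintegral_dyadic_mean _ _ _ _ _ (fun t w => semigroup X P (r * t) h (X s w)) 1)//.
    - apply: eq_dyadic_mean => t t0; rewrite mulrDr.
      by rewrite -(semigroupD Xstd z s0 (rt0 t t0) mh h01).
    - exact: prob_lty.
    - move=> t t0; apply: (measurable_state_comp Xstd s0).
      exact: (measurable_semigroup Xstd (rt0 t t0) mh h01).
    - by move=> t w t0 _; exact: n1.
  under eq_fun do rewrite E1.
  have c3 : \int[P z]_w dyadic_mean (fun t => semigroup X P (r * t) h (X s w)) n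
      @[n --> \oo] --> \int[P z]_w time_average r h (X s w).
    refine (@bounded_cvg_Rintegral _ _ _ (P z) setT
      (fun n w => dyadic_mean (fun t => semigroup X P (r * t) h (X s w)) n)
      (fun w => time_average r h (X s w)) 1 measurableT _ _ _ _).
    - exact: prob_lty.
    - move=> n; apply: measurable_funM; first exact: measurable_cst.
      apply: measurable_sum => k.
      apply: (measurable_state_comp Xstd s0).
      apply: (measurable_semigroup Xstd _ mh h01).
      by rewrite rt0// mulr_ge0// ltW// dyadic_pos.
    - move=> n w _.
      have /andP[? ?] : 0 <= dyadic_mean (fun t => semigroup X P (r * t) h (X s w)) n <= 1.
        by apply: dyadic_mean_bound => t t0; exact: b01.
      by rewrite ger0_norm.
    - by move=> w _; exact: (dyadic_mean_cvg (n1 (X s w)) (rc (X s w))).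
  exact: c3.
apply: (cvgr_to_le (cvg_norm (cvgB c2 c1))).
exists m => // n /= mn.
exact: (dyadic_mean_shift j (b01 z) mn).
Qed.

End TimeAverage.

(** * Uniform confinement on short times *)

Section Confinement.
Context (R : realType) (E : pointedMetricType R) (d : measure_display)
  (Omega : measurableType d) (F : R -> set (set Omega)) (X : R -> Omega -> E)
  (P : E -> probability Omega R) (Xstd : standard_markov_process F X P)
  (Ec : closed_balls_compact E) (Xfeller : weakly_feller X P).

(** Presenting [F t] as the measurable sets of a generated sigma-algebra makes the closure lemmas
    for measurable sets available for it. *)
Lemma filtration_measurableE (t : R) : 0 <= t ->
  F t = @measurable _ (g_sigma_algebraType (F t)).
Proof. by move=> t0; rewrite [RHS](sigma_algebra_id (filtration_sigma Xstd t0)). Qed.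

Lemma filtration_state (s t : R) (V : set E) : 0 <= s -> s <= t -> open V ->
  F t (X s @^-1` V).
Proof.
move=> s0 st oV; apply: (filtration_le Xstd s0 st).
by apply: (smp_adapted Xstd s0); exact: sub_sigma_algebra.
Qed.

Lemma integrable_state_in (y : E) (t : R) (h : E -> R) (A : set Omega) :
  0 <= t -> measurable A -> measurable_fun setT (h : borel E -> R) ->
  (forall z, 0 <= h z <= 1) -> (P y).-integrable A (EFin \o (fun w => h (X t w))).
Proof.
move=> t0 mA mh h01; apply: (integrable_bounded (M := 1)) => //; first exact: prob_lty.
  by apply: measurable_funTS; exact: (measurable_state_comp Xstd).
by move=> w _; have /andP[? ?] := h01 (X t w); rewrite ger0_norm.
Qed.

Lemma integrable_prob_cst (y : E) (c : R) (A : set Omega) :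
  measurable A -> (P y).-integrable A (EFin \o (fun=> c)).
Proof.
move=> mA; apply: (integrable_bounded (M := `|c|)) => //; exact: prob_lty.
Qed.

(* Discrete optional stopping: decompose according to the first grid time at
   which the path is in [V]. *)
Lemma maximal_inequality_grid (q : E -> R) (V : set E) (c kappa eps : R) (y : E)
    (m : nat) :
  continuous q -> (forall z, 0 <= q z <= 1) -> open V ->
  (forall z, V z -> c <= q z) -> 0 <= kappa -> 0 < eps ->
  (forall j, (j <= 2 ^ m)%N -> forall z,
     q z <= semigroup X P (eps * (j%:R * 2 ^- m)) q z + kappa) ->
  c * fine (P y (\big[setU/set0]_(k < (2 ^ m).+1)
    (X (eps * (k%:R * 2 ^- m)) @^-1` V))) <= semigroup X P eps q y + kappa.
Proof.
move=> cq q01 oV cV k0 e0 qS.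
have mq := measurable_continuous cq.
pose s k : R := eps * (k%:R * 2 ^- m).
have s0 k : 0 <= s k by rewrite !mulr_ge0// ltW// dyadic_pos.
have sle i k : (i <= k)%N -> s i <= s k.
  by move=> ik; rewrite ler_pM2l// ler_pM2r ?dyadic_pos// ler_nat.
pose G k := X (s k) @^-1` V; pose A := seqDU G.
have FA k : F (s k) (A k).
  rewrite filtration_measurableE//; apply: measurableD.
    by rewrite -filtration_measurableE//; exact: filtration_state.
  apply: bigsetU_measurable => i _.
  rewrite -filtration_measurableE//; apply: filtration_state => //.
  by apply: sle; exact: ltnW.
have mA k : measurable (A k) := filtration_measurable Xstd (s0 k) (FA k).
pose B n := \big[setU/set0]_(k < n) A k.
have mB n : measurable (B n) by apply: bigsetU_measurable => i _.
have Pfin C : measurable C -> P y C \is a fin_num by move=> mC; exact: prob_fin_num.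
(* On [A k], where [V] is first visited at the grid time [s k], [c] is at most [q (X (s k) w)]. The
   hypothesis on [q] over the remaining time [eps - s k] and the Markov property carry this bound to
   time [eps]. *)
have step k : (k <= 2 ^ m)%N -> c * fine (P y (A k)) <=
    \int[P y]_(w in A k) q (X eps w) + kappa * fine (P y (A k)).
  move=> km.
  rewrite -!Rintegral_cst//.
  have te : eps = s k + eps * ((2 ^ m - k)%:R * 2 ^- m).
    rewrite /s -mulrDr -mulrDl -natrD subnKC// natrX divff ?mulr1//.
  have t0 : 0 <= eps * ((2 ^ m - k)%:R * 2 ^- m).
    by rewrite !mulr_ge0 ?(ltW e0)// ltW// dyadic_pos.
  have := markov_property Xstd y (s0 k) t0 (FA k) mq q01.
  rewrite -te => <-.
  have mS := measurable_semigroup Xstd t0 mq q01.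
  have S01 z := semigroup_bound Xstd z t0 mq q01.
  have iS := integrable_state_in y (s0 k) (mA k) mS S01.
  have iK := integrable_prob_cst y kappa (mA k).
  rewrite -RintegralD//; apply: le_Rintegral => //.
  - exact: integrable_prob_cst.
  - by have := integrableD (mA k) iS iK; apply: eq_integrable.
  - move=> w [Vw _]; apply: (le_trans (cV _ Vw)); apply: qS; exact: leq_subr.
have main n : (n <= (2 ^ m).+1)%N -> c * fine (P y (B n)) <=
    \int[P y]_(w in B n) q (X eps w) + kappa * fine (P y (B n)).
  elim: n => [|n IH] nm.
    by rewrite /B big_ord0 measure0 Rintegral_set0 !mulr0 addr0.
  have BA : B n `&` A n = set0.
    rewrite /B -bigsetU_seqDU; apply/seteqP; split => // w [+ [_ +]].
    by move=> h /(_ h).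
  rewrite /B big_ord_recr/= -/(B n) measureU// fineD ?Pfin//.
  rewrite Rintegral_setU//; last 2 first.
  - apply: integrable_state_in => //; [exact: ltW|exact: measurableU].
  - by rewrite disj_set2E; apply/eqP.
  by have h1 := IH (ltnW nm); have h2 := step n nm; lra.
rewrite (bigsetU_seqDU G); have {}main := main _ (leqnn _).
rewrite (le_trans main)// lerD//.
- rewrite /semigroup.
  rewrite Rintegral_mkcond; apply: le_Rintegral => //.
  + have := integrable_state_in y (ltW e0) (mB (2 ^ m).+1) mq q01.
    rewrite (integrable_mkcond _ (mB _)); apply: eq_integrable => // w _.
    by rewrite /= restrict_EFin.
  + exact: (integrable_state_in y (ltW e0) measurableT mq q01).
  + move=> w _; rewrite patchE; case: ifP => // _.
    by case/andP: (q01 (X eps w)).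
- rewrite ler_piMr// -lee_fin fineK ?Pfin//.
  exact: probability_le1.
Qed.

(** The grid events increase with [m], so their union obeys the same bound. They catch every visit
    to the open set [V]: a visit at [u < eps] lasts for a while by right continuity, long enough to
    meet a fine grid, and [u = eps] is itself a grid time. *)
Lemma maximal_inequality (q : E -> R) (V : set E) (c kappa eps : R) (y : E) :
  continuous q -> (forall z, 0 <= q z <= 1) -> open V ->
  0 < c -> (forall z, V z -> c <= q z) -> 0 <= kappa -> 0 < eps ->
  (forall m j, (j <= 2 ^ m)%N -> forall z,
     q z <= semigroup X P (eps * (j%:R * 2 ^- m)) q z + kappa) ->
  exists B : set Omega, [/\ measurable B,
    (P y B <= ((semigroup X P eps q y + kappa) / c)%:E)%E &
    forall w, ~ B w -> forall u, 0 <= u <= eps -> ~ V (X u w)].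
Proof.
move=> cq q01 oV c0 cV k0 e0 qS.
pose B m := \big[setU/set0]_(k < (2 ^ m).+1) (X (eps * (k%:R * 2 ^- m)) @^-1` V).
have s0 k m : 0 <= eps * (k%:R * 2 ^- m) by rewrite !mulr_ge0 ?(ltW e0)// ltW// dyadic_pos.
have mB m : measurable (B m).
  apply: bigsetU_measurable => k _; apply: (filtration_measurable Xstd (s0 k m)).
  exact: filtration_state.
have BP m w : B m w <-> exists2 k, (k <= 2 ^ m)%N & V (X (eps * (k%:R * 2 ^- m)) w).
  rewrite /B -(@bigcup_mkord _ _ (fun k => X (eps * (k%:R * 2 ^- m)) @^-1` V)).
  by split=> [[k /= km Vk]|[k km Vk]]; exists k.
have Bnd : nondecreasing_seq B.
  apply/nondecreasing_seqP => m; apply/subsetPset => w /BP[k km Vk].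
  apply/BP; exists (k * 2)%N; first by rewrite expnSr leq_mul2r km.
  rewrite (_ : (k * 2)%:R * 2 ^- m.+1 = k%:R * 2 ^- m :> R)//.
  by rewrite natrM exprS; field; rewrite expf_neq0.
exists (\bigcup_m B m); split.
- exact: bigcup_measurable.
- have := nondecreasing_cvg_mu mB (bigcup_measurable (fun m _ => mB m)) Bnd (mu := P y).
  move/cvge_to_le; apply; apply: nearW => m /=.
  rewrite -[leLHS]fineK ?prob_fin_num// lee_fin ler_pdivlMr// mulrC.
  by apply: maximal_inequality_grid => // j jm z; exact: qS.
move=> w Bw u /andP[u0]; rewrite le_eqVlt => /predU1P[->|ue] Vu; apply: Bw.
  exists 0%N => //; apply/BP; exists 1%N => //.
  by rewrite expr0 invr1 !mulr1.
have [rc _] := smp_cadlag Xstd w.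
have : \forall v \near u^'+, V (X v w) by exact: (rc u u0 _ (open_nbhs_nbhs (conj oV Vu))).
move=> [e /= e1 He].
pose t := u / eps.
have t0 : 0 <= t by rewrite divr_ge0// ltW.
have t1 : t < 1 by rewrite ltr_pdivrMr// mul1r.
have ee0 : 0 < e / eps by rewrite divr_gt0.
(* One grid step [eps * 2 ^- m] is shorter than [e], so the first grid time after [u] falls while
   the path is still in [V]. *)
have /cvgrPdist_lt/(_ _ ee0)[m _ /(_ m (leqnn m))] := @dyadic_cvg0 R.
rewrite /= sub0r normrN gtr0_norm ?dyadic_pos// => me.
have /andP[v1 v2] := dyadic_upper m t0.
exists m => //; apply/BP; exists (Num.truncn (t * 2 ^+ m)).+1.
  exact: dyadic_upper_index.
set v := _.+1%:R * 2 ^- m in v1 v2 *.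
have tu : u = eps * t by rewrite /t mulrC divfK// gt_eqF.
have uv : u < eps * v by rewrite tu ltr_pM2l.
apply: He => //=; rewrite distrC gtr0_norm ?subr_gt0//.
rewrite tu -mulrBr mulrC -ltr_pdivlMr// (le_lt_trans _ me)//.
by rewrite lerBlDl.
Qed.

Lemma cvg_sum_ord (T : Type) (A : set_system T) (FA : Filter A) (N : nat)
    (f : nat -> T -> R) (l : nat -> R) :
  (forall k, (k < N)%N -> f k x @[x --> A] --> l k) ->
  \sum_(k < N) f k x @[x --> A] --> \sum_(k < N) l k.
Proof.
elim: N => [|N IH] h.
  by under eq_fun do rewrite big_ord0; rewrite big_ord0; exact: cvg_cst.
under eq_fun do rewrite big_ord_recr/=; rewrite big_ord_recr/=.
by apply: cvgD; [apply: IH => k kN; apply: h; exact: ltnW|exact: h].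
Qed.

(* Compactness upgrades the pointwise convergence of the time averages of a
   bump function to a uniform separation of [x] from distant points. *)
Lemma time_average_separation (x : E) (delta : R) : 0 < delta ->
  exists n0 N : nat, [/\
    forall k, 3 / 4 <= time_average X P (2 ^- (n0 + k)) (bump x delta) x &
    forall z, delta <= mdist x z -> exists2 k, (k < N)%N &
      time_average X P (2 ^- (n0 + k)) (bump x delta) z <= 1 / 2].
Proof.
move=> d0; pose u n := time_average X P (2 ^- n) (bump x delta).
have b01 z := bump_bound x z d0.
have bC := bump_C0 x Ec d0.
have cu n : continuous (u n) := time_average_continuous Xstd Xfeller (dyadic_pos n) bC b01.
have uC n : C0 (u n) := time_average_C0 Xstd Ec Xfeller (dyadic_pos n) bC b01.
have cvgu z : u n z @[n --> \oo] --> bump x delta z.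
  exact: (time_average_cvg0 Xstd (@bump_continuous _ _ x delta) b01).
(* The levels 3/4 at [x] and 1/2 far away leave the gap 1/4 used in [separating_function]. *)
have [n0 _ Hn0] : \forall n \near \oo, 3 / 4 < u n x.
  by apply: (cvgr_gt _ (cvgu x)); rewrite bump_center; lra.
(* Otherwise there are far points [z N] at which the first [N] averages all exceed 1/2. As [u n0]
   vanishes at infinity, they stay in a compact set from index 1 on and have a cluster point [p]. By
   continuity every average from [n0] on is at least 1/2 at [p], whereas these averages tend to
   [bump x delta p = 0]. *)
have /existsNP[N HN] : ~ forall N, exists z, delta <= mdist x z /\
    forall k, (k < N)%N -> 1 / 2 < u (n0 + k)%N z.
  move=> /choice[z hz].
  have [K cK HK] := (uC n0).2 (1 / 2) ltac:(lra).
  have zK : (z @ \oo) K.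
    exists 1%N => // n /= n1; apply: contrapT => /HK.
    have [_ /(_ 0%N n1)] := hz n; rewrite addn0 => h.
    by rewrite ltNge (le_trans (ltW h))// ler_norm.
  have [p [Kp clp]] := cK _ _ zK.
  have clP (g : E -> R) (a b : R) : {for p, continuous g} -> g p < a -> b = a ->
      ~ (\forall n \near \oo, b <= g (z n)).
    move=> cg ga -> hn.
    have [y [/= y1 y2]] := clp [set y | a <= g y] [set y | g y < a] hn (cvgr_lt _ cg _ ga).
    by move: y2; rewrite ltNge y1.
  have dp : delta <= mdist x p.
    rewrite leNgt; apply/negP => dp.
    apply: (clP (mdist x) delta delta) => //; first exact: mdist_continuous.
    by apply: nearW => n; case: (hz n).
  have up k : 1 / 2 <= u (n0 + k)%N p.
    rewrite leNgt; apply/negP => dk.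
    apply: (clP (u (n0 + k)%N) (1 / 2) (1 / 2)) => //; first exact: cu.
    by exists k.+1 => // n /= kn; rewrite ltW//; case: (hz n) => _; apply.
  have [n1 _ Hn1] : \forall n \near \oo, u n p < 1 / 2.
    by apply: (cvgr_lt _ (cvgu p)); rewrite bump_far//; lra.
  have := Hn1 (n0 + n1)%N (leq_addl _ _); have := up n1; rewrite /=; lra.
exists n0, N; split => [k|z dz]; first by apply/ltW/Hn0 => /=; rewrite leq_addr.
apply: contrapT => h; apply: HN; exists z; split => // k kN.
by rewrite ltNge; apply/negP => uk; apply: h; exists k.
Qed.

End Confinement.

(** * Separating function and confinement near a point *)

Section Separation.
Context (R : realType) (E : pointedMetricType R) (d : measure_display)
  (Omega : measurableType d) (F : R -> set (set Omega)) (X : R -> Omega -> E)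
  (P : E -> probability Omega R) (Xstd : standard_markov_process F X P)
  (Ec : closed_balls_compact E) (Xfeller : weakly_feller X P).

(** The separating function has a limit at infinity that may differ from 0. The Feller property
    applies after subtracting this constant, which the semigroup preserves. *)
Lemma semigroup_cst_shift_continuous (t D : R) (g : E -> R) : 0 <= t -> C0 g ->
  continuous (semigroup X P t (fun z => g z + D)).
Proof.
move=> t0 gC; have cg := gC.1.1.
have [M [_ HM]] := gC.1.2.
have -> : semigroup X P t (fun z => g z + D) = (fun z => semigroup X P t g z + D).
  apply/funext => z; rewrite /semigroup RintegralD//.
  - by rewrite Rintegral_prob.
  - apply: (integrable_bounded (M := M + 1)) => //; first exact: prob_lty.
      by apply: (measurable_state_comp Xstd) => //; exact: measurable_continuous.
    by move=> w _; apply: HM => //; rewrite ltrDl.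
  - exact: integrable_prob_cst.
by move=> z; apply: cvgD; [exact: (Xfeller t0 gC).1.1|exact: cvg_cst].
Qed.

(** Jensen's inequality bounds [|P_t u z - c|] by [P_t |u - c|] at [z], and replacing [P_t u z] by
    [u z] costs [kappa]. Thus distances of [u] to a constant are nearly subharmonic. *)
Lemma semigroup_dist (t c kappa : R) (u : E -> R) (z : E) : 0 <= t -> continuous u ->
  (forall y, 0 <= u y <= 1) -> `|semigroup X P t u z - u z| <= kappa ->
  `|u z - c| <= semigroup X P t (fun y => `|u y - c|) z + kappa.
Proof.
move=> t0 cu u01 hk.
have iu : (P z).-integrable setT (EFin \o (fun w => u (X t w))).
  apply: (integrable_state_in Xstd z t0 measurableT _ u01).
  exact: measurable_continuous.
have ic := integrable_prob_cst P z c measurableT.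
have iuc : (P z).-integrable setT (EFin \o (fun w => u (X t w) - c)).
  have := integrableB measurableT iu ic; apply: eq_integrable => //.
have h1 : semigroup X P t u z - c = \int[P z]_w (u (X t w) - c).
  by rewrite RintegralB// Rintegral_prob.
have h2 : `|semigroup X P t u z - c| <= semigroup X P t (fun y => `|u y - c|) z.
  by rewrite h1; exact: le_normr_Rintegral.
rewrite (le_trans (ler_distD (semigroup X P t u z) _ _))// addrC lerD//.
by rewrite distrC.
Qed.

(** [q] averages [|u_k - u_k x|] over finitely many scales [k]: each term vanishes at [x], at every
    far point some term is at least 1/4, and each term is nearly subharmonic by
    [semigroup_time_average] and [semigroup_dist]. *)
Lemma separating_function (x : E) (delta : R) : 0 < delta ->
  exists (q : E -> R) (c : R),
    [/\ continuous q, forall z, 0 <= q z <= 1, q x = 0, 0 < c &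
      forall z, delta <= mdist x z -> c <= q z] /\
    (forall t, 0 <= t -> continuous (semigroup X P t q)) /\
    (forall kappa : R, 0 < kappa -> exists e0, forall e, (e0 <= e)%N ->
      forall m j, (j <= 2 ^ m)%N -> forall z,
        q z <= semigroup X P (2 ^- e * (j%:R * 2 ^- m)) q z + kappa).
Proof.
move=> d0; have [n0 [N [Hx Hfar]]] := time_average_separation Xstd Ec Xfeller x d0.
have b01 z := bump_bound x z d0.
have bC := bump_C0 x Ec d0.
pose u k := time_average X P (2 ^- (n0 + k)) (bump x delta).
have cu k : continuous (u k) := time_average_continuous Xstd Xfeller (dyadic_pos _) bC b01.
have uC k : C0 (u k) := time_average_C0 Xstd Ec Xfeller (dyadic_pos _) bC b01.
have u01 k z : 0 <= u k z <= 1.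
  exact: (time_average_bound Xstd z (dyadic_pos _) (@bump_continuous _ _ x delta) b01).
pose v k z : R := `|u k z - u k x|.
have cv k : continuous (v k).
  move=> z; apply: cvg_norm; apply: cvgB; [exact: cu|exact: cvg_cst].
have v01 k z : 0 <= v k z <= 1.
  rewrite normr_ge0/= /v ler_norml.
  by have /andP[? ?] := u01 k z; have /andP[? ?] := u01 k x; apply/andP; split; lra.
have N0 : 0 < N.+1%:R^-1 :> R by rewrite invr_gt0.
(* Taking [N.+1] terms keeps the normalising factor positive whatever [N] is. *)
pose q z := N.+1%:R^-1 * \sum_(k < N.+1) v k z.
have q01 z : 0 <= q z <= 1.
  rewrite mulr_ge0 ?(ltW N0)//=; last by apply: sumr_ge0 => k _; case/andP: (v01 k z).
  rewrite ler_pdivrMl// mulr1.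
  have : \sum_(k < N.+1) v k z <= \sum_(k < N.+1) 1.
    by apply: ler_sum => k _; case/andP: (v01 k z).
  by rewrite sumr_const card_ord.
have cq : continuous q.
  move=> z; apply: cvgM; first exact: cvg_cst.
  by apply: (@cvg_sum_ord _ _ _ _ _ v (v ^~ z)) => k _; exact: cv.
exists q, (N.+1%:R^-1 * (1 / 4)); split; [split => //|split].
- by rewrite /q big1 ?mulr0// => k _; rewrite /v subrr normr0.
- move=> z /Hfar[k kN uk]; rewrite ler_pM2l//.
  rewrite (bigD1 (Ordinal (ltnW kN : (k < N.+1)%N)))//=.
  rewrite ler_wpDr//; first by apply: sumr_ge0 => i _; case/andP: (v01 i z).
  have := Hx k; rewrite -/(u k x) => ux.
  rewrite /v distrC ger0_norm; rewrite -/(u k z) in uk; lra.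
(* [D] is the limit of [q] at infinity, because every [u k] vanishes there and [u k x] is
   non-negative. *)
- move=> t t0; pose D := N.+1%:R^-1 * \sum_(k < N.+1) u k x.
  pose g z := q z - D.
  have -> : q = (fun z => g z + D) by apply/funext => z; rewrite /g subrK.
  apply: semigroup_cst_shift_continuous => //.
  apply: (@C0_seq _ _ _ x) => // [|w hw].
    apply: (@Cb_intro _ _ _ (1 + `|D|)).
      by move=> z; apply: cvgB; [exact: cq|exact: cvg_cst].
    move=> z; rewrite (le_trans (ler_normB _ _))// lerD2r.
    by have /andP[? ?] := q01 z; rewrite ger0_norm.
  rewrite -[X in _ --> X](subrr D); apply: cvgB; last exact: cvg_cst.
  apply: cvgM; first exact: cvg_cst.
  apply: (@cvg_sum_ord _ _ _ _ _ (fun k n => v k (w n)) (u ^~ x)) => k _.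
  rewrite (_ : u k x = `|0 - u k x|); last first.
    by rewrite sub0r normrN ger0_norm//; case/andP: (u01 k x).
  apply: cvg_norm; apply: cvgB; last exact: cvg_cst.
  exact: (C0_far (uC k) hw).
- move=> kappa k0.
  have /cvgrPdist_le/(_ _ k0)[e1 _ /(_ e1 (leqnn e1))] := @dyadic_cvg0 R.
  rewrite /= sub0r normrN gtr0_norm ?dyadic_pos// => he1.
  (* For [k <= N] the time [t <= 2 ^- e] is at most [2 ^- e1] times the scale [2 ^- (n0 + k)] of
     [u k], and [2 ^- e1 <= kappa]. *)
  exists (n0 + N + e1)%N => e e0e m j jm z.
  set t := 2 ^- e * _.
  have t0 : 0 <= t by rewrite !mulr_ge0 ?(ltW (dyadic_pos _)).
  have vS k : (k < N.+1)%N -> v k z <= semigroup X P t (v k) z + kappa.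
    move=> kN; apply: semigroup_dist => //.
    have ke : (n0 + k <= e)%N.
      by rewrite (leq_trans _ e0e)// -addnA leq_add2l (leq_trans _ (leq_addr _ _)).
    (* Relative to the scale of [u k], [t] is again a dyadic grid time, of a finer level. *)
    have -> : t = 2 ^- (n0 + k) * (j%:R * 2 ^- (m + (e - (n0 + k)))).
      rewrite /t -{1}(subnKC ke) !exprD.
      by field; rewrite !expf_neq0.
    apply: (le_trans (semigroup_time_average Xstd Xfeller _ _ _ _ bC b01)).
      exact: dyadic_pos.
    apply: le_trans he1.
    rewrite exprD invfM mulrA.
    rewrite (@le_trans _ _ (1 * 2 ^- (e - (n0 + k))))//.
      rewrite ler_pM2r ?dyadic_pos// ler_pdivrMr ?exprn_gt0// mul1r.
      by rewrite -natrX ler_nat.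
    rewrite mul1r lef_pV2 ?posrE ?exprn_gt0// ler_weXn2l ?ler1n//.
    rewrite leq_subRL// (leq_trans _ e0e)// leq_add2r leq_add2l.
    by rewrite -ltnS.
  have -> : semigroup X P t q z = N.+1%:R^-1 * \sum_(k < N.+1) semigroup X P t (v k) z.
    have iv k : (P z).-integrable setT (EFin \o (fun w => v k (X t w))).
      apply: (integrable_state_in Xstd z t0 measurableT _ (v01 k)).
      exact: measurable_continuous (cv k).
    have iq : (P z).-integrable setT (EFin \o (fun w => \sum_(k < N.+1) v k (X t w))).
      apply: (integrable_bounded (M := N.+1%:R)) => //; first exact: prob_lty.
        apply: measurable_sum => k; apply: (measurable_state_comp Xstd) => //.
        exact: measurable_continuous (cv k).
      move=> w _; rewrite (le_trans (ler_norm_sum _ _ _))//.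
      have : \sum_(k < N.+1) `|v k (X t w)| <= \sum_(k < N.+1) 1.
        by apply: ler_sum => k _; have /andP[? ?] := v01 k (X t w); rewrite ger0_norm.
      by rewrite sumr_const card_ord.
    rewrite /semigroup RintegralZl//; congr (_ * _).
    exact: (@Rintegral_sum _ _ _ (P z) setT N.+1 (fun k w => v k (X t w))).
  rewrite /q -[kappa](mulKf (lt0r_neq0 (ltr0Sn R N))) -mulrDr ler_pM2l//.
  apply: (@le_trans _ _ (\sum_(k < N.+1) (semigroup X P t (v k) z + kappa))).
    by apply: ler_sum => k _; apply: vS.
  by rewrite big_split/= sumr_const card_ord mulr_natl.
Qed.

(** The maximal inequality for [q] bounds the probability of leaving the ball by
    [(P_eps q y + kappa) / c]. Half of [eta] pays for [kappa]. The other half pays for [P_eps q y],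
    which is small at [x] for small [eps] because [q x = 0], and near [x] by continuity of
    [P_eps q]. *)
Lemma confinement (x : E) (delta eta : R) : 0 < delta -> 0 < eta ->
  exists2 eps : R, 0 < eps & \forall y \near x, exists B : set Omega,
    [/\ measurable B, (P y B <= eta%:E)%E &
      forall w, ~ B w -> forall u, 0 <= u <= eps -> mdist x (X u w) <= delta].
Proof.
move=> d0 eta0.
have [q [c [[cq q01 qx c0 cfar] [cS qS]]]] := separating_function x d0.
have k0 : 0 < c * eta / 2 by rewrite divr_gt0// mulr_gt0.
have [e0 He0] := qS _ k0.
have Sx : semigroup X P (2 ^- e) q x @[e --> \oo] --> 0.
  rewrite -[X in _ --> X]qx -(semigroup0 Xstd x (measurable_continuous cq) q01).
  have /cvg_at_rightP := semigroup_right_continuous Xstd (z := x) (lexx 0) cq q01.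
  by apply; split; [move=> n; exact: dyadic_pos|exact: dyadic_cvg0].
have [e1 _ He1] := cvgr_lt _ Sx _ k0.
pose e := maxn e0 e1; exists (2 ^- e); first exact: dyadic_pos.
have Sxe : semigroup X P (2 ^- e) q x < c * eta / 2 by apply: He1 => /=; exact: leq_maxr.
have Se : \forall y \near x, semigroup X P (2 ^- e) q y < c * eta / 2.
  by apply: (cvgr_lt _ (cS _ (ltW (dyadic_pos e)) x) _ Sxe).
apply: filterS Se => y Sy.
have oV := open_mdist_gt x delta.
have [|B [mB PB HB]] := @maximal_inequality _ _ _ _ _ _ _ Xstd q
   [set z | delta < mdist x z] c (c * eta / 2) (2 ^- e) y cq q01 oV c0 _ (ltW k0)
   (dyadic_pos e) (He0 e (leq_maxl _ _)).
  by move=> z /= dz; apply: cfar; exact: ltW.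
exists B; split => //.
  apply: (le_trans PB); rewrite lee_fin ler_pdivrMr// mulrC.
  by move: Sy; lra.
by move=> w /HB Bw u /Bw /= /negP; rewrite -leNgt.
Qed.

End Separation.

(** * Exit times *)

Section ExitTime.
Context (R : realType) (E : pointedMetricType R) (d : measure_display)
  (Omega : measurableType d) (F : R -> set (set Omega)) (X : R -> Omega -> E)
  (P : E -> probability Omega R) (Xstd : standard_markov_process F X P).

Lemma exit_time_ge0 (O : set E) (w : Omega) : (0 <= exit_time X O w)%E.
Proof. by apply: le_ereal_inf_tmp => _ [t [t0 _] <-]; rewrite lee_fin. Qed.

Lemma exit_time_le (O : set E) (w : Omega) (t : R) : 0 <= t -> ~ O (X t w) ->
  (exit_time X O w <= t%:E)%E.
Proof. by move=> t0 Ot; apply: ereal_inf_lbound; exists t. Qed.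

Lemma exit_time_lt (O : set E) (w : Omega) (a : \bar R) :
  (exit_time X O w < a)%E -> exists t : R, [/\ 0 <= t, (t%:E < a)%E & ~ O (X t w)].
Proof. by move=> /ereal_inf_lt[_ [t [t0 Ot] <-] ta]; exists t. Qed.

Lemma exit_time_sub (O O' : set E) (w : Omega) : O `<=` O' ->
  (exit_time X O w <= exit_time X O' w)%E.
Proof.
move=> OO'; apply: le_ereal_inf_tmp => _ [t [t0 Ot] <-].
by apply: exit_time_le => // /OO'.
Qed.

Lemma path_near_right (V : set E) (w : Omega) (t : R) : 0 <= t -> open V ->
  V (X t w) -> exists2 e : R, 0 < e & forall v, t <= v < t + e -> V (X v w).
Proof.
move=> t0 oV Vt; have [rc _] := smp_cadlag Xstd w.
have [e /= e0 He] : \forall v \near t^'+, V (X v w).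
  exact: (rc t t0 _ (open_nbhs_nbhs (conj oV Vt))).
exists e => // v /andP[]; rewrite le_eqVlt => /predU1P[<-//|tv ve].
by apply: He => //=; rewrite distrC gtr0_norm ?subr_gt0// ltrBlDl.
Qed.

Lemma exit_time_gt0 (O : set E) (w : Omega) : open O -> O (X 0 w) ->
  (0 < exit_time X O w)%E.
Proof.
move=> oO O0; have [e e0 He] := path_near_right (lexx 0) oO O0.
apply: (@lt_le_trans _ _ e%:E); first by rewrite lte_fin.
apply: le_ereal_inf_tmp => _ [t [t0 Ot] <-]; rewrite lee_fin leNgt.
by apply/negP => te; apply: Ot; apply: He; rewrite t0 add0r.
Qed.

(** The exit time from the complement of [V] is the hitting time of [V]. By right continuity a visit
    to an open set lasts for a while, hence includes a rational time. *)
Lemma exit_timeC_lt_rat (V : set E) (w : Omega) (a : R) : open V ->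
  (exit_time X (~` V) w < a%:E)%E <->
  exists q : rat, [/\ 0 <= ratr q :> R, ratr q < a & V (X (ratr q) w)].
Proof.
move=> oV; split=> [/exit_time_lt[t [t0 ta /contrapT Vt]]|[q [q0 qa Vq]]].
  rewrite lte_fin in ta.
  have [e e0 He] := path_near_right t0 oV Vt.
  have : t < Num.min a (t + e) by rewrite lt_min ta ltrDl.
  move=> /rat_in_itvoo[q]; rewrite in_itv/= lt_min => /andP[tq /andP[qa qe]].
  exists q; split => //; first by rewrite (le_trans t0)// ltW.
  by apply: He; rewrite (ltW tq).
by apply: (@le_lt_trans _ _ (ratr q)%:E); [apply: exit_time_le|rewrite lte_fin].
Qed.

(** For each [s > t], the event that [V] is hit by time [t] is the intersection of the events of a
    hit before [a n], with [a n <= s] decreasing to [t]; these are countable unions over rational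
    times, hence in [F s]. Right continuity of the filtration concludes. *)
Lemma exit_timeC_stopping (V : set E) : open V ->
  stopping_time F (exit_time X (~` V)).
Proof.
move=> oV; split => [w|t t0]; first exact: exit_time_ge0.
rewrite (smp_right_continuous Xstd t0) => s /= ts.
have s0 : 0 <= s by rewrite (le_trans t0)// ltW.
pose a n : R := t + (s - t) / n.+1%:R.
have an n : a n <= s.
  by rewrite /a -lerBrDl ler_pdivrMr// ler_peMr ?subr_ge0 ?ler1n// ltW.
pose Q n (q : rat) : set Omega :=
  if (0 <= ratr q :> R) && (ratr q < a n) then X (ratr q) @^-1` V else set0.
rewrite (_ : [set w | _] = \bigcap_n \bigcup_q Q n q).
  rewrite (filtration_measurableE Xstd s0); apply: bigcapT_measurable => n.
  apply: bigcupT_measurable_rat => q.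
  rewrite -(filtration_measurableE Xstd s0) /Q; case: ifPn => [/andP[q0 qa]|_].
    by apply: (filtration_state Xstd q0) => //; rewrite (le_trans (ltW qa)).
  by case: (filtration_sigma Xstd s0).
have QP n w : (\bigcup_q Q n q) w <-> (exit_time X (~` V) w < (a n)%:E)%E.
  rewrite exit_timeC_lt_rat//; split => [[q _]|[q [q0 qa Vq]]].
    by rewrite /Q; case: ifPn => // /andP[q0 qa] Vq; exists q.
  by exists q => //; rewrite /Q q0 qa.
apply/seteqP; split => w /=.
  move=> wt n _; apply/QP; rewrite (le_lt_trans wt)// lte_fin ltrDl.
  by rewrite divr_gt0// subr_gt0.
move=> h; apply/lee_addgt0Pr => e e0.
have [n] : exists n : nat, (s - t) / e < n.+1%:R.
  exists (Num.truncn ((s - t) / e)); exact: truncnS_gt.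
rewrite ltr_pdivrMr// => ne; have /QP := h n I.
move=> /ltW/le_trans; apply; rewrite -EFinD lee_fin lerD2l.
by rewrite ler_pdivrMr// mulrC ltW.
Qed.

Definition near_complement (O : set E) (n : nat) : set E :=
  [set z | exists2 p, ~ O p & mdist p z < n.+1%:R^-1].

Lemma near_complement_open (O : set E) n : open (near_complement O n).
Proof.
rewrite openE => z [p Op pz]; apply: nbhs_mdist.
exists (n.+1%:R^-1 - mdist p z); first by rewrite subr_gt0.
move=> y zy; exists p => //.
by rewrite (le_lt_trans (metric_triangle p z y))// -ltrBrDl.
Qed.

Lemma near_complement_le (O : set E) n m : (n <= m)%N ->
  near_complement O m `<=` near_complement O n.
Proof.
move=> nm z [p Op pz]; exists p => //; apply: (lt_le_trans pz).
by rewrite lef_pV2 ?posrE// ler_nat.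
Qed.

Lemma setC_near_complement (O : set E) n : ~` near_complement O n `<=` O.
Proof.
by move=> z hz; apply: contrapT => Oz; apply: hz; exists z => //; rewrite mdistxx.
Qed.

(** At the hitting time the path may only be adherent to the open set. A visit shortly afterwards,
    at a point closer than [n.+1%:R^-1] to the current one, accounts for the factor 2. *)
Lemma near_complement_exit (O : set E) n w (t : R) : 0 <= t ->
  exit_time X (~` near_complement O n) w = t%:E ->
  exists2 p, ~ O p & mdist p (X t w) < 2 / n.+1%:R.
Proof.
move=> t0 et; have n0 : 0 < n.+1%:R^-1 :> R by rewrite invr_gt0.
have oB := open_mdist_lt (X t w) n.+1%:R^-1.
have [e e0 He] : exists2 e : R, 0 < e &
    forall v, t <= v < t + e -> mdist (X t w) (X v w) < n.+1%:R^-1.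
  by apply: (path_near_right t0 oB); rewrite /= mdistxx.
have /exit_time_lt[u [u0 ue /contrapT[p Op pu]]] :
    (exit_time X (~` near_complement O n) w < (t + e)%:E)%E.
  by rewrite et lte_fin ltrDl.
rewrite lte_fin in ue.
have tu : t <= u.
  by rewrite -lee_fin -et; apply: exit_time_le => //; apply; exists p.
exists p => //; have := metric_triangle p (X u w) (X t w).
have := He u; rewrite tu ue => /(_ isT); rewrite (metric_sym (X u w) (X t w)).
have -> : 2 / n.+1%:R = n.+1%:R^-1 + n.+1%:R^-1 :> R by rewrite mulrDl mul1r.
by move=> h /le_lt_trans; apply; rewrite ltrD.
Qed.

(* The exit time from [O] need not be measurable, but by quasi-left-continuity
   it is almost surely the supremum of the hitting times of the shrinking open
   neighbourhoods of the complement of [O]. *)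
Lemma exit_time_approx (O : set E) (t : R) : open O ->
  exists D : set Omega, [/\ measurable D,
    forall w, D w -> (t%:E < exit_time X O w)%E &
    forall x, exists N : set Omega, [/\ measurable N, P x N = 0%E &
      forall w, ~ N w -> ~ D w -> (exit_time X O w <= t%:E)%E]].
Proof.
move=> oO.
pose T n w := exit_time X (~` near_complement O n) w.
pose tau w := ereal_sup (range (T ^~ w)).
have Tst n : stopping_time F (T n).
  exact: exit_timeC_stopping (near_complement_open O n).
have Tnd w : nondecreasing_seq (T ^~ w).
  move=> n m nm; apply: exit_time_sub; apply: subsetC.
  exact: near_complement_le.
have Tcv w : T n w @[n --> \oo] --> tau w by exact: ereal_nondecreasing_cvgn.
have Ttau n w : (T n w <= tau w)%E by apply: ereal_sup_ubound; exists n.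
have mT n : measurable [set w | (T n w <= t%:E)%E].
  have [t0|t0] := leP 0 t.
    by apply: (filtration_measurable Xstd t0); case: (Tst n) => _; apply.
  rewrite (_ : [set w | _] = set0)//; apply/seteqP; split => // w /= Tt.
  have := le_trans ((Tst n).1 w) Tt; rewrite lee_fin; lra.
(* Every [T n] is at most the exit time, hence so is [tau]. *)
exists [set w | (t%:E < tau w)%E]; split.
- rewrite (_ : [set w | _] = \bigcup_n ~` [set w | (T n w <= t%:E)%E]).
    by apply: bigcup_measurable => n _; exact: measurableC.
  apply/seteqP; split => w /=.
    move=> /ereal_sup_gt[_ [n _ <-] tT]; exists n => //=.
    by apply/negP; rewrite -ltNge.
  by move=> [n _ /= /negP]; rewrite -ltNge => /lt_le_trans; apply.
- move=> w /= /lt_le_trans; apply; apply: ge_ereal_sup => _ [n _ <-].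
  exact: exit_time_sub (@setC_near_complement O n).
(* Off a null set the positions at the times [T n] converge to the position at [tau] when
   [tau w <= t]. They approach the complement of [O], which is closed, so the path is outside [O] at
   time [tau]. *)
move=> x; have [N [mN N0 HN]] := smp_quasi_left_continuous Xstd Tst Tnd Tcv x.
exists N; split => // w Nw /negP; rewrite -leNgt => tau_t.
have tau_fin : (tau w < +oo)%E by rewrite (le_lt_trans tau_t)// ltry.
have cX : X (fine (T n w)) w @[n --> \oo] --> X (fine (tau w)) w.
  by apply: contrapT => h; apply: Nw; apply: HN => /= /(_ tau_fin).
have T0 n : (0 <= T n w)%E := (Tst n).1 w.
have Tfin n : T n w \is a fin_num.
  by rewrite ge0_fin_numE// (le_lt_trans (Ttau n w)).
have tau0 : (0 <= tau w)%E := le_trans (T0 0%N) (Ttau 0%N w).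
have tauE : tau w = (fine (tau w))%:E by rewrite fineK// ge0_fin_numE.
apply: le_trans tau_t; rewrite tauE; apply: exit_time_le; first exact: fine_ge0.
move=> OX.
have /nbhs_ballP[r /= r0] := open_nbhs_nbhs (conj oO OX).
rewrite ballEmdist => rO.
have r2 : 0 < r / 2 by rewrite divr_gt0.
have h1 : \forall n \near \oo, mdist (X (fine (tau w)) w) (X (fine (T n w)) w) < r / 2.
  exact: cvg_mdist_lt cX r2.
have h2 : \forall n \near \oo, 2 / n.+1%:R < r / 2.
  exists (Num.truncn (4 / r)) => // n /= hn.
  have : 4 / r < n.+1%:R by rewrite (lt_le_trans (truncnS_gt _))// ler_nat.
  by rewrite !ltr_pdivrMr//; lra.
have [n _ /(_ n (leqnn n))[]] := filterI h1 h2.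
move=> d1 d2; have [p Op dp] : exists2 p, ~ O p &
    mdist p (X (fine (T n w)) w) < 2 / n.+1%:R.
  by apply: near_complement_exit; [exact: fine_ge0|rewrite fineK].
apply: Op; apply: rO => /=.
have := metric_triangle (X (fine (tau w)) w) (X (fine (T n w)) w) p.
rewrite (metric_sym (X (fine (T n w)) w) p) => /le_lt_trans; apply.
by rewrite [r]splitr ltrD// (lt_trans dp).
Qed.

(** The indicator of the possibly non-measurable event [t < exit_time] dominates that of [D]. So
    [P y D] is at most the killed semigroup of 1, which is continuous and is 0 at [x], where paths
    start outside [O]. *)
Lemma exit_soon (O : set E) (x : E) (t eta : R) : open O -> ~ O x -> 0 < eta ->
  0 < t -> Cb (killed_semigroup X P O t (fun=> 1)) ->
  \forall y \near x, exists B : set Omega, [/\ measurable B, (P y B <= eta%:E)%E &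
    forall w, ~ B w -> (exit_time X O w <= t%:E)%E].
Proof.
move=> oO Ox eta0 t0 [ck _]; have [D [mD DO HD]] := exit_time_approx t oO.
have k1 y : (\int[P y]_w (\1_[set w' | (t%:E < exit_time X O w')%E] w * 1)%:E <= 1)%E.
  apply: (@le_trans _ _ (\int[P y]_w (cst 1%E) w)%E).
    apply: le_integral_nomeas => w _; rewrite mulr1 indicE lee_fin.
    by case: (_ \in _).
  by rewrite integral_cst// mul1e probability_le1.
have k0 y : (0 <= \int[P y]_w (\1_[set w' | (t%:E < exit_time X O w')%E] w * 1)%:E)%E.
  by apply: integral_ge0 => w _; rewrite mulr1 indicE lee_fin.
have kfin y : (\int[P y]_w (\1_[set w' | (t%:E < exit_time X O w')%E] w * 1)%:E)%E
    \is a fin_num.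
  by rewrite ge0_fin_numE// (le_lt_trans (k1 y))// ltry.
have kE y : (killed_semigroup X P O t (fun=> 1) y)%:E =
    (\int[P y]_w (\1_[set w' | (t%:E < exit_time X O w')%E] w * 1)%:E)%E.
  by rewrite /killed_semigroup /Rintegral fineK//; exact: kfin.
have kx : killed_semigroup X P O t (fun=> 1) x = 0.
  have [N [mN N0 HN]] := state0_null Xstd x.
  apply/eqP; rewrite eq_le; apply/andP; split; last by rewrite -lee_fin kE.
  rewrite -lee_fin kE (_ : 0%:E = P x (N `&` setT)) ?setIT//.
  rewrite -(setIT N) -integral_indic//.
  apply: le_integral_nomeas => w _; rewrite mulr1 lee_fin !indicE ler_nat.
  have [Nw|Nw] := pselect (N w); first by rewrite [w \in N]mem_set// leq_b1.
  rewrite memNset//= => h; move: Ox; rewrite -(HN w Nw).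
  move=> /(exit_time_le (lexx 0)); rewrite leNgt => /negP; apply.
  by rewrite (lt_trans _ h)// lte_fin.
have ky : \forall y \near x, killed_semigroup X P O t (fun=> 1) y < eta.
  by apply: (cvgr_lt _ (ck x)); rewrite kx.
apply: filterS ky => y ky.
have [N [mN N0 HN]] := HD y.
exists (D `|` N); split; first exact: measurableU.
  apply: (le_trans (measureU2 _ mD mN)); rewrite [X in (_ + X)%E](_ : _ = 0%E)// adde0.
  apply: (@le_trans _ _ (killed_semigroup X P O t (fun=> 1) y)%:E); last first.
    by rewrite lee_fin ltW.
  apply: (@le_trans _ _ (\int[P y]_w (\1_D w)%:E)%E).
    by rewrite integral_indic// setIT.
  rewrite kE.
  apply: le_integral_nomeas => w _; rewrite mulr1 lee_fin !indicE ler_nat.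
  have [Dw|Dw] := pselect (D w); last by rewrite memNset.
  by rewrite [X in (_ <= nat_of_bool X)%N]mem_set ?leq_b1//; exact: DO.
by move=> w /not_orP[Dw Nw]; exact: HN.
Qed.

End ExitTime.

(** * Payoffs *)

Section Payoff.
Context (R : realType) (E : pointedMetricType R) (d : measure_display)
  (Omega : measurableType d) (F : R -> set (set Omega)) (X : R -> Omega -> E)
  (P : E -> probability Omega R) (Xstd : standard_markov_process F X P).

Lemma Cb_time_space_bound (g : R * E -> R) : Cb_time_space g ->
  exists2 M : R, 0 < M & forall t z, 0 <= t -> `|g (t, z)| <= M.
Proof.
move=> [_ [M [_ HM]]]; exists (`|M| + 1); first by rewrite ltr_wpDl.
move=> t z t0; apply: (HM (`|M| + 1)) => //=.
by rewrite (le_lt_trans (ler_norm M))// ltrDl.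
Qed.

Lemma discounted_continuity (g : R * E -> R) (alpha s eta : R) (x : E) :
  Cb_time_space g -> 0 < alpha -> 0 <= s -> 0 < eta ->
  exists e : R, 0 < e /\ forall t z, 0 <= t <= e -> mdist x z <= e ->
    `|expR (- alpha * t) * g (s + t, z) - g (s, x)| <= eta.
Proof.
move=> [cg _] a0 s0 eta0.
have eta2 : 0 < eta / 2 by rewrite divr_gt0.
have /subspace_continuousP/(_ (s, x) s0)/cvgrPdist_le/(_ _ eta2) := cg.
rewrite near_withinE => -[[A B] /= [nA nB]] HAB.
have [e1 /= e10 He1] := nA; have /nbhs_ballP[e2 /= e20 He2] := nB.
(* [e3] keeps the discount error [alpha * t * |g (s, x)|] below [eta / 2]; the added 1 avoids a zero
   denominator. *)
pose e3 := eta / 2 / (alpha * (`|g (s, x)| + 1)).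
have g1 : 0 < `|g (s, x)| + 1 by rewrite ltr_wpDl.
have e30 : 0 < e3 by rewrite divr_gt0// mulr_gt0.
pose e := Num.min (e1 / 2) (Num.min (e2 / 2) e3).
have e0 : 0 < e by rewrite !lt_min e30 !divr_gt0.
have ee1 : e < e1 by rewrite gt_min ltr_pdivrMr// ltr_pMr// ltr1n.
have ee2 : e < e2 by rewrite !gt_min [e2 / 2 < e2]ltr_pdivrMr// ltr_pMr// ltr1n orbT.
have ee3 : e <= e3 by rewrite !ge_min lexx !orbT.
exists e; split => // t z /andP[t0 te] xz.
have st0 : 0 <= s + t by rewrite addr_ge0.
have h1 : `|g (s, x) - g (s + t, z)| <= eta / 2.
  apply: (HAB (s + t, z)) => //; split => /=.
    apply: He1 => /=; rewrite opprD addrA subrr sub0r normrN ger0_norm//.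
    exact: le_lt_trans ee1.
  by apply: He2; rewrite ballEmdist; exact: (le_lt_trans xz).
have x1 : expR (- alpha * t) <= 1.
  by rewrite -expR0 ler_expR mulNr oppr_le0 mulr_ge0// ltW.
have x2 : 1 - alpha * t <= expR (- alpha * t).
  by have := expR_ge1Dx (- alpha * t); rewrite mulNr.
have at_ : alpha * t * `|g (s, x)| <= eta / 2.
  have : alpha * t * (`|g (s, x)| + 1) <= eta / 2.
    rewrite mulrAC mulrC -ler_pdivlMr ?mulr_gt0//.
    exact: (le_trans te ee3).
  apply: le_trans; apply: ler_wpM2l; first by rewrite mulr_ge0// ltW.
  by rewrite lerDl.
have -> : expR (- alpha * t) * g (s + t, z) - g (s, x) =
  expR (- alpha * t) * (g (s + t, z) - g (s, x)) - (1 - expR (- alpha * t)) * g (s, x).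
  by ring.
rewrite (le_trans (ler_normB _ _))// !normrM [eta]splitr lerD//.
  rewrite (@le_trans _ _ (1 * `|g (s + t, z) - g (s, x)|))//.
    by rewrite ler_wpM2r// ger0_norm// expR_ge0.
  by rewrite mul1r distrC.
apply: le_trans at_; rewrite ler_wpM2r//.
by rewrite ger0_norm ?subr_ge0//; lra.
Qed.

(** The dominating function [M * e^(-alpha u)] is [M / alpha] times the exponential density, of
    total mass 1. *)
Lemma running_payoff_bound (f : R * E -> R) (alpha s M : R) (T : \bar R) (w : Omega) :
  0 < alpha -> 0 <= s -> (0 <= T)%E -> (forall t z, 0 <= t -> `|f (t, z)| <= M) ->
  `|running_payoff X alpha f s T w| <= M / alpha.
Proof.
move=> a0 s0 T0 fM.
have M0 : 0 <= M by apply: le_trans (fM 0 point (lexx 0)).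
have Ma0 : 0 <= M / alpha by rewrite divr_ge0// ltW.
have ie : lebesgue_measure.-integrable setT
    (EFin \o (fun u : R => M / alpha * exponential_pdf alpha u)).
  have := integrableZl measurableT (M / alpha) (integrable_exponential_pdf a0).
  by apply: eq_integrable.
have g0 u : 0 <= M / alpha * exponential_pdf alpha u.
  by rewrite mulr_ge0// exponential_pdf_ge0// ltW.
rewrite /running_payoff Rintegral_mkcond.
apply: (le_trans (normr_Rintegral_le measurableT ie _)).
  move=> u _; rewrite patchE; case: ifPn => [/set_mem[u0 uT]|_]; last by rewrite normr0.
  rewrite exponential_pdfE// normrM ger0_norm ?expR_ge0//.
  rewrite mulrA divfK ?gt_eqF// mulrC ler_wpM2r ?expR_ge0//.
  by apply: fM; rewrite addr_ge0.
rewrite RintegralZl//; last exact: (integrable_exponential_pdf a0).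
by rewrite /Rintegral integral_exponential_pdf//= mulr1.
Qed.

Lemma running_payoff_small (f : R * E -> R) (alpha s M : R) (T : \bar R) (e : R)
    (w : Omega) :
  0 < alpha -> 0 <= s -> (0 <= T)%E -> (T <= e%:E)%E ->
  (forall t z, 0 <= t -> `|f (t, z)| <= M) ->
  `|running_payoff X alpha f s T w| <= M * e.
Proof.
move: T => [t| |] // a0 s0; rewrite !lee_fin => t0 te fM.
have M0 : 0 <= M by apply: le_trans (fM 0 point (lexx 0)).
have DE : [set u : R | 0 <= u /\ (u%:E <= t%:E)%E] = `[0, t]%classic.
  by apply/seteqP; split => u /=; rewrite in_itv/= lee_fin => /andP.
have mD : measurable ([set u : R | 0 <= u /\ (u%:E <= t%:E)%E] : set R).
  by rewrite DE; exact: measurable_itv.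
have muD : lebesgue_measure [set u : R | 0 <= u /\ (u%:E <= t%:E)%E] = t%:E.
  rewrite DE lebesgue_measure_itv/= lte_fin; case: ltP => // t0'.
    by rewrite oppr0 adde0.
  by congr EFin; apply/eqP; rewrite eq_le t0.
have muDy : (lebesgue_measure [set u : R | (0 <= u)%R /\ (u%:E <= t%:E)%E] < +oo)%E.
  by rewrite muD ltry.
have h : `|running_payoff X alpha f s t%:E w| <= \int[lebesgue_measure]_(u in
    [set u : R | 0 <= u /\ (u%:E <= t%:E)%E]) M.
  apply: normr_Rintegral_le => //.
    by apply: (integrable_bounded (M := `|M|)).
  move=> u [u0 _]; rewrite normrM ger0_norm ?expR_ge0//.
  rewrite (@le_trans _ _ (1 * M))//; last by rewrite mul1r.
  rewrite ler_pM ?expR_ge0//.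
    by rewrite -expR0 ler_expR mulNr oppr_le0 mulr_ge0// ltW.
  by apply: fM; rewrite addr_ge0.
apply: (le_trans h); rewrite Rintegral_cst//.
by apply: ler_wpM2l => //; move/(congr1 fine): muD => /= ->.
Qed.

Lemma discounted_payoff_bound (g : R * E -> R) (alpha s M : R) (T : \bar R) (w : Omega) :
  0 < alpha -> 0 <= s -> (0 <= T)%E -> (forall t z, 0 <= t -> `|g (t, z)| <= M) ->
  `|discounted_payoff X alpha g s T w| <= M.
Proof.
move=> a0 s0 + gM; have M0 : 0 <= M by apply: le_trans (gM 0 point (lexx 0)).
case: T => [t| |] //=; rewrite ?normr0// lee_fin => t0.
rewrite normrM ger0_norm ?expR_ge0// (@le_trans _ _ (1 * M))//; last by rewrite mul1r.
rewrite ler_pM ?expR_ge0//.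
  by rewrite -expR0 ler_expR mulNr oppr_le0 mulr_ge0// ltW.
by apply: gM; rewrite addr_ge0.
Qed.

(** The integrand of [J], named so that it can be estimated path by path. *)
Definition payoff (O : set E) (alpha : R) (f G H : R * E -> R) (s : R)
    (tau : Omega -> \bar R) (w : Omega) : R :=
  running_payoff X alpha f s (Order.min (tau w) (exit_time X O w)) w
  + \1_[set w' | (tau w' < exit_time X O w')%E] w
      * discounted_payoff X alpha G s (tau w) w
  + \1_[set w' | (exit_time X O w' <= tau w')%E] w
      * discounted_payoff X alpha H s (exit_time X O w) w.

Lemma payoff_before O alpha f G H s tau w : (tau w < exit_time X O w)%E ->
  payoff O alpha f G H s tau w = running_payoff X alpha f s (tau w) w
    + discounted_payoff X alpha G s (tau w) w.
Proof.
move=> h; rewrite /payoff !indicE mem_set// memNset/=; last first.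
  by apply/negP; rewrite -ltNge.
by rewrite min_l ?(ltW h)// mul1r mul0r addr0.
Qed.

Lemma payoff_after O alpha f G H s tau w : (exit_time X O w <= tau w)%E ->
  payoff O alpha f G H s tau w = running_payoff X alpha f s (exit_time X O w) w
    + discounted_payoff X alpha H s (exit_time X O w) w.
Proof.
move=> h; rewrite /payoff !indicE memNset/=; last by apply/negP; rewrite -leNgt.
by rewrite mem_set// min_r// mul1r mul0r addr0.
Qed.

(** The payoff lies below [c + C * 1_B]; the integrals are compared by [le_integral_nomeas], since
    the exit time in the payoff may fail to be measurable. *)
Lemma J_le (O : set E) alpha f G H s x tau (c C : R) (B : set Omega) :
  measurable B -> 0 <= C ->
  (forall w, ~ B w -> payoff O alpha f G H s tau w <= c) ->
  (forall w, payoff O alpha f G H s tau w <= c + C) ->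
  (J X P O alpha f G H s x tau <= c%:E + C%:E * P x B)%E.
Proof.
move=> mB C0 hB hC; rewrite /J unlock.
have mI : measurable_fun setT (fun w => (\1_B w : R)%:E) by exact/measurable_EFinP.
have C0' : (0 <= C%:E)%E by [].
have -> : (c%:E + C%:E * P x B = \int[P x]_w (c + C * \1_B w)%:E)%E.
  under eq_integral do rewrite EFinD.
  rewrite integralD//=.
  - rewrite integral_cst//= (_ : P x setT = 1%E) ?mule1; last exact: (probability_setT (P x)).
    congr (_ + _)%E; under eq_integral do rewrite EFinM.
    by rewrite ge0_integralZl// integral_indic// setIT.
  - exact: (integrable_prob_cst P x c measurableT).
  - apply: (integrable_bounded (M := C)) => //; first exact: prob_lty.
      exact: measurable_funM.
    move=> w _; rewrite indicE; case: (_ \in _); rewrite ?mulr1 ?mulr0 ?normr0//.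
    by rewrite ger0_norm.
apply: le_integral_nomeas => w _; rewrite lee_fin [\1_B w]indicE.
have [Bw|Bw] := pselect (B w); first by rewrite mem_set// mulr1; exact: hC.
by rewrite memNset// mulr0 addr0; exact: hB.
Qed.

Lemma J_ge (O : set E) alpha f G H s x tau (c C : R) (B : set Omega) :
  measurable B -> 0 <= C ->
  (forall w, ~ B w -> c <= payoff O alpha f G H s tau w) ->
  (forall w, c - C <= payoff O alpha f G H s tau w) ->
  (c%:E - C%:E * P x B <= J X P O alpha f G H s x tau)%E.
Proof.
move=> mB C0 hB hC; rewrite /J unlock.
have mI : measurable_fun setT (fun w => (\1_B w : R)%:E) by exact/measurable_EFinP.
have C0' : (0 <= C%:E)%E by [].
have -> : (c%:E - C%:E * P x B = \int[P x]_w (c - C * \1_B w)%:E)%E.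
  under eq_integral do rewrite EFinB.
  rewrite integralB//=.
  - rewrite integral_cst//= (_ : P x setT = 1%E) ?mule1; last exact: (probability_setT (P x)).
    congr (_ - _)%E; under eq_integral do rewrite EFinM.
    by rewrite ge0_integralZl// integral_indic// setIT.
  - exact: (integrable_prob_cst P x c measurableT).
  - apply: (integrable_bounded (M := C)) => //; first exact: prob_lty.
      exact: measurable_funM.
    move=> w _; rewrite indicE; case: (_ \in _); rewrite ?mulr1 ?mulr0 ?normr0//.
    by rewrite ger0_norm.
apply: le_integral_nomeas => w _; rewrite lee_fin [\1_B w]indicE.
have [Bw|Bw] := pselect (B w); first by rewrite mem_set// mulr1; exact: hC.
by rewrite memNset// mulr0 subr0; exact: hB.
Qed.

Lemma stopping_time0 : stopping_time F (fun=> 0%E).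
Proof.
split => // t t0; rewrite (_ : [set w | _] = setT); first exact: (filtration_setT Xstd).
by apply/seteqP; split => // w _ /=; rewrite lee_fin.
Qed.

Lemma stopping_timey : stopping_time F (fun=> +oo%E).
Proof.
split => [w|t t0]; first by rewrite leey.
rewrite (_ : [set w | _] = set0); first by case: (filtration_sigma Xstd t0).
by apply/seteqP; split => // w /=; rewrite leye_eq.
Qed.

End Payoff.

(** * Limit of the value function at a boundary point *)

Theorem theorem1 (R : realType) (E : pointedMetricType R)
  (E_locally_compact : locally_compact [set: E])
  (E_separable : separable_space E)
  (E_closed_balls : closed_balls_compact E)
  (d : measure_display) (Omega : measurableType d)
  (F : R -> set (set Omega)) (X : R -> Omega -> E)
  (P : E -> probability Omega R)
  (X_standard : standard_markov_process F X P)
  (X_feller : weakly_feller X P)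
  (O : set E) (O_open : open O)
  (alpha : R) (alpha_gt0 : 0 < alpha)
  (f G H : R * E -> R)
  (f_Cb : Cb_time_space f) (G_Cb : Cb_time_space G) (H_Cb : Cb_time_space H)
  (killed_Cb : forall t : R, 0 < t ->
     forall h : E -> R, Cb h -> Cb (killed_semigroup X P O t h))
  (s : R) (s_ge0 : 0 <= s) (x : E) (x_boundary : boundary O x) :
  value F X P O alpha f G H s y @[y --> within O (nbhs x)] -->
    (Num.max (G (s, x)) (H (s, x)))%:E.
Proof.
have Ox : ~ O x.
  case: x_boundary => _ nO Ox; apply: nO; exact: (open_nbhs_nbhs (conj O_open Ox)).
have [Mf Mf0 HMf] := Cb_time_space_bound f_Cb.
have [MG MG0 HMG] := Cb_time_space_bound G_Cb.
have [MH MH0 HMH] := Cb_time_space_bound H_Cb.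
have Cb1 : Cb ((fun=> 1) : E -> R).
  by apply: (@Cb_intro _ _ _ 1) => [y|y]; [exact: cvg_cst|rewrite normr1].
pose m := Num.max (G (s, x)) (H (s, x)).
have Gs := HMG s x s_ge0; have Hs := HMH s x s_ge0.
pose Z tau w := payoff X O alpha f G H s tau w.
(* The first three terms bound every payoff and the last two bound the limit [m], so [C] controls
   the error on exceptional events. *)
pose C := Mf / alpha + MG + MH + MG + MH.
have fa0 : 0 < Mf / alpha by rewrite divr_gt0.
have C0 : 0 < C by rewrite !addr_gt0.
have Zb tau w : (forall w, 0 <= tau w)%E -> `|Z tau w| <= Mf / alpha + MG + MH.
  move=> tau0; have e0 := exit_time_ge0 X O w.
  have [h|h] := ltP (tau w) (exit_time X O w).
    rewrite /Z payoff_before// (le_trans (ler_normD _ _))//.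
    have := running_payoff_bound X w alpha_gt0 s_ge0 (tau0 w) HMf.
    have := discounted_payoff_bound X w alpha_gt0 s_ge0 (tau0 w) HMG.
    lra.
  rewrite /Z payoff_after// (le_trans (ler_normD _ _))//.
  have := running_payoff_bound X w alpha_gt0 s_ge0 e0 HMf.
  have := discounted_payoff_bound X w alpha_gt0 s_ge0 e0 HMH.
  lra.
have main eta : 0 < eta -> \forall y \near x, O y ->
    ((m - eta)%:E <= value F X P O alpha f G H s y <= (m + eta)%:E)%E.
  (* The three thirds pay for the running payoff, the terminal payoff and the exceptional event. *)
  move=> eta0; pose eta' := eta / 3.
  have eta'0 : 0 < eta' by rewrite divr_gt0.
  have [eG [eG0 HG]] := discounted_continuity x G_Cb alpha_gt0 s_ge0 eta'0.
  have [eH [eH0 HH]] := discounted_continuity x H_Cb alpha_gt0 s_ge0 eta'0.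
  pose delta := Num.min eG eH.
  have delta0 : 0 < delta by rewrite lt_min eG0.
  (* Two exceptional events of this probability cost at most [eta'] when the error on them is at
     most [C]. *)
  have p0 : 0 < eta' / C / 2 by rewrite !divr_gt0.
  have [e1 e10 conf] := confinement X_standard E_closed_balls X_feller x delta0 p0.
  (* Up to [t1] the path is confined, [G] and [H] vary little, and the running payoff is at most
     [Mf * t1 <= eta']. *)
  pose t1 := Num.min e1 (Num.min delta (eta' / Mf)).
  have t10 : 0 < t1 by rewrite lt_min e10/= lt_min delta0/= divr_gt0.
  have t1e : t1 <= e1 by rewrite ge_min lexx.
  have t1G : t1 <= eG by rewrite !ge_min lexx !orbT.
  have t1H : t1 <= eH by rewrite !ge_min lexx !orbT.
  have t1M : Mf * t1 <= eta'.
    by rewrite mulrC -ler_pdivlMr// !ge_min lexx !orbT.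
  have soon := exit_soon X_standard O_open Ox p0 t10 (killed_Cb t1 t10 _ Cb1).
  (* Off [B1] the path stays within [delta] of [x] up to [t1]; off [B2] it has left [O] by [t1]. *)
  apply: filterS2 conf soon => y [B1 [mB1 PB1 HB1]] [B2 [mB2 PB2 HB2]] Oy.
  pose B := B1 `|` B2.
  have mB : measurable B by exact: measurableU.
  have PB : (C%:E * P y B <= eta'%:E)%E.
    have : (P y B <= (eta' / C / 2)%:E + (eta' / C / 2)%:E)%E.
      by rewrite (le_trans (measureU2 _ mB1 mB2))// leeD.
    rewrite -EFinD -splitr => h; rewrite (le_trans (lee_wpmul2l _ h)) ?lee_fin ?(ltW C0)//.
    by rewrite mulrC divfK// gt_eqF.
  have good tau w : (forall w, 0 <= tau w)%E -> ~ B w ->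
      ((tau w < exit_time X O w)%E -> `|Z tau w - G (s, x)| <= eta' + eta') /\
      ((exit_time X O w <= tau w)%E -> `|Z tau w - H (s, x)| <= eta' + eta').
    move=> tau0 /not_orP[nB1 nB2]; have e0 := exit_time_ge0 X O w.
    have et1 := HB2 w nB2.
    have Xd u : 0 <= u <= t1 -> mdist x (X u w) <= delta.
      by move=> /andP[u0 ut]; apply: HB1 => //; rewrite u0 (le_trans ut).
    split => h.
      rewrite /Z payoff_before//.
      have tt1 : (tau w <= t1%:E)%E by rewrite (le_trans (ltW h)).
      have := running_payoff_small X w alpha_gt0 s_ge0 (tau0 w) tt1 HMf.
      move: (tau0 w) tt1; case: (tau w) => [t| |]//; rewrite !lee_fin => t0 tt1 hr.
      rewrite -addrA (le_trans (ler_normD _ _))// lerD ?(le_trans hr)//=.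
      apply: HG; first by rewrite t0 (le_trans tt1).
      by rewrite (le_trans (Xd t _)) ?t0// ge_min lexx.
    rewrite /Z payoff_after//.
    have := running_payoff_small X w alpha_gt0 s_ge0 e0 et1 HMf.
    move: e0 et1; case: (exit_time X O w) => [t| |]//; rewrite !lee_fin => t0 tt1 hr.
    rewrite -addrA (le_trans (ler_normD _ _))// lerD ?(le_trans hr)//=.
    apply: HH; first by rewrite t0 (le_trans tt1).
    by rewrite (le_trans (Xd t _)) ?t0// ge_min lexx orbT.
  have Gm : G (s, x) <= m by rewrite le_max lexx.
  have Hm : H (s, x) <= m by rewrite le_max lexx orbT.
  have eE : eta = eta' + eta' + eta' by rewrite /eta'; lra.
  apply/andP; split.
    (* For the lower bound, stopping at once yields nearly [G (s, x)] and never stopping nearly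
       [H (s, x)]; the larger one is chosen. Off [N] the path starts at [y] in [O], so the exit time
       is positive and stopping at 0 precedes it. *)
    have [N [mN N0 HN]] := state0_null X_standard y.
    suff [tau st hJ] : exists2 tau, stopping_time F tau &
        ((m - eta)%:E <= J X P O alpha f G H s y tau)%E.
      by apply: (le_trans hJ); apply: ereal_sup_ubound; exists tau.
    pose B' := B `|` N.
    have mB' : measurable B' by exact: measurableU.
    have PB' : P y B' = P y B.
      by rewrite measureU0.
    have lowr tau (c : R) : stopping_time F tau -> m = c -> `|c| <= MG + MH ->
        (forall w, ~ B' w -> `|Z tau w - c| <= eta' + eta') ->
        ((m - eta)%:E <= J X P O alpha f G H s y tau)%E.
      move=> st mc cM hc.
      apply: (@le_trans _ _ ((c - (eta' + eta'))%:E - C%:E * P y B')%E).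
        rewrite PB' mc eE [(c - _)%:E](_ : _ = (c - (eta' + eta'))%:E - eta'%:E)%E.
          by rewrite leeB.
        by rewrite -EFinB; congr EFin; lra.
      apply: J_ge => //; first exact: ltW.
        by move=> w /hc; rewrite ler_norml => /andP[h _]; rewrite -/(Z tau w); lra.
      move=> w; have := Zb tau w st.1; rewrite -/(Z tau w) ler_norml => /andP[h _].
      move: cM; rewrite ler_norml => /andP[_ h2]; rewrite /C; lra.
    have [HG'|GH] := leP (H (s, x)) (G (s, x)).
      exists (fun=> 0%E); first exact: stopping_time0 X_standard.
      apply: (lowr _ (G (s, x))); [exact: stopping_time0 X_standard|exact: max_l| |].
        by lra.
      move=> w /not_orP[nB nN]; apply: (good _ w _ nB).1 => //.
      by apply: (exit_time_gt0 X_standard O_open); rewrite HN.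
    exists (fun=> +oo%E); first exact: stopping_timey X_standard.
    apply: (lowr _ (H (s, x))); [exact: stopping_timey X_standard|exact/max_r/ltW| |].
      by lra.
    move=> w /not_orP[nB nN]; apply: (good _ w _ nB).2; last exact: leey.
    by move=> w'; rewrite leey.
  (* The upper bound is uniform in [tau] because [B] was chosen before the stopping time. *)
  apply: ge_ereal_sup => _ [tau st <-].
  apply: (@le_trans _ _ ((m + (eta' + eta'))%:E + C%:E * P y B)%E); last first.
    rewrite eE [leRHS](_ : _ = (m + (eta' + eta'))%:E + eta'%:E)%E.
      by rewrite leeD2l.
    by rewrite -EFinD; congr EFin; lra.
  apply: J_le => //; first exact: ltW.
    move=> w nB; have [hG hH] := good tau w st.1 nB; rewrite -/(Z tau w).
    have [h|h] := ltP (tau w) (exit_time X O w).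
      by move: (hG h); rewrite ler_norml => /andP[_ ?]; lra.
    by move: (hH h); rewrite ler_norml => /andP[_ ?]; lra.
  move=> w; have := Zb tau w st.1; rewrite -/(Z tau w) ler_norml => /andP[_ h].
  move: Gs; rewrite ler_norml => /andP[h2 _]; rewrite /C; lra.
(* A limit in the extended reals amounts to eventual finiteness, given by [main] with [eta = 1], and
   convergence of the real values. *)
rewrite -/m; apply/fine_cvgP; split.
  have := main 1 ltr01; apply: filterS => y h Oy.
  move: (h Oy) => /andP[h1 h2]; rewrite fin_numElt.
  by rewrite (lt_le_trans _ h1) ?ltNyr// (le_lt_trans h2)// ltry.
apply/cvgrPdist_le => eta eta0; have := main eta eta0.
apply: filterS => y h Oy; move: (h Oy) => /=.
case: (value F X P O alpha f G H s y) => [v| |]; rewrite ?leye_eq ?leeNy_eq ?andbF//.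
by rewrite !lee_fin ler_norml /= => /andP[h1 h2]; apply/andP; split; lra.
Qed.
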